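(* Let $(q_k,p_{k1},p_{k2})_{k\ge2}$ be real numbers with $q_k>0$, $p_{k1}\ge0$, $p_{k2}>0$ and $q_k+p_{k1}+p_{k2}=1$ for all $k\ge2$, let $X$, $Y$ be the (2,1) and (1,2) random walks defined in the context, and let $Z\in\{X,Y\}$. For $n\ge2$ let $S_n=\#\{k\in[2,n]: k \text{ is a cutpoint of } Z\}$. Suppose that $a_k\to a>0$ and $b_k\to b>0$ as $k\to\infty$. Fix $\beta\ge0$ and let $r_n$ be as in the context. Assume $\varrho_k=1-3r_k+O(r_k^2)$ as $k\to\infty$ if $Z=X$, and $\varrho_k=1+3r_k+O(r_k^2)$ as $k\to\infty$ if $Z=Y$. If $0\le\beta<1$, then there are constants $0<c_3<c_4<\infty$ such that $$c_3\le \liminf_{n\to\infty}\frac{ES_n}{\log n(\log\log n)^{-\beta}}\le\limsup_{n\to\infty}\frac{ES_n}{\log n(\log\log n)^{-\beta}}\le c_4,$$ and for each $\varepsilon>0$, $$\lim_{n\to\infty}\frac{S_n}{(\log n)^{1+\varepsilon}(\log\log n)^{-\beta}}=0\quad\text{almost surely.}$$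
   Context: $\mathbb Z_+=\{0,1,2,\dots\}$. The (2,1) random walk $X$ is the Markov chain on $\mathbb Z_+$ with $X_0=2$, $P(X_{k+1}=1\mid X_k=0)=P(X_{k+1}=2\mid X_k=1)=1$ and, for $n\ge2$, $P(X_{k+1}=n+1\mid X_k=n)=q_n$, $P(X_{k+1}=n-1\mid X_k=n)=p_{n1}$, $P(X_{k+1}=n-2\mid X_k=n)=p_{n2}$. The (1,2) random walk $Y$ is the Markov chain on $\mathbb Z_+$ with $Y_0=2$, $P(Y_{k+1}=0\mid Y_k=1)=P(Y_{k+1}=2\mid Y_k=0)=1$ and, for $n\ge2$, $P(Y_{k+1}=n-1\mid Y_k=n)=q_n$, $P(Y_{k+1}=n+1\mid Y_k=n)=p_{n1}$, $P(Y_{k+1}=n+2\mid Y_k=n)=p_{n2}$. For $k\ge2$, $a_k=(p_{k1}+p_{k2})/q_k$, $b_k=p_{k2}/q_k$, $\varrho_k=\frac{a_k+\sqrt{a_k^2+4b_k}}{2}$. A site $k$ is a cutpoint of $X$ if $X$ visits $k$ exactly once; $k$ is a cutpoint of $Y$ if $Y$ never visits $k$. For fixed $\beta\ge0$: $r_n=\frac13\left(\frac1n+\frac{1}{n(\log\log n)^\beta}\right)$ for $n\ge4$ and $r_2=r_3=r_4$. *)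

(* Defs.v *)
From HB Require Import structures.
From mathcomp Require Import all_boot all_order all_algebra.
From mathcomp Require Import all_classical all_reals all_analysis.
Set Implicit Arguments. Unset Strict Implicit. Unset Printing Implicit Defensive.
Import Order.TTheory GRing.Theory Num.Theory.
Import numFieldNormedType.Exports.
Local Open Scope classical_set_scope.
Local Open Scope ring_scope.

Inductive walk_kind := W21 | W12.

Section Defs.
Context {R : realType}.

Definition trans (w : walk_kind) (q p1 p2 : nat -> R) (m n : nat) : R :=
  match w with
  | W21 =>
    if m == 0%N then (if n == 1%N then 1 else 0)
    else if m == 1%N then (if n == 2%N then 1 else 0)
    else if n == m.+1 then q m
    else if n == m.-1 then p1 m
    else if n == m.-2 then p2 m
    else 0
  | W12 =>
    if m == 1%N then (if n == 0%N then 1 else 0)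
    else if m == 0%N then (if n == 2%N then 1 else 0)
    else if n == m.-1 then q m
    else if n == m.+1 then p1 m
    else if n == m.+2 then p2 m
    else 0
  end.

Definition is_walk (w : walk_kind) (q p1 p2 : nat -> R)
  {d : measure_display} {T : measurableType d} (P : probability T R)
  (Z : nat -> T -> nat) : Prop :=
  (forall k n, measurable [set o | Z k o = n]) /\
  forall (n : nat) (x : nat -> nat),
    P [set o | forall i, (i <= n)%N -> Z i o = x i] =
    ((if x 0%N == 2%N then 1 else 0) *
     \prod_(i < n) trans w q p1 p2 (x i) (x i.+1))%:E.

Definition cutpoint (w : walk_kind) {T : Type} (Z : nat -> T -> nat)
  (k : nat) (o : T) : Prop :=
  match w with
  | W21 => exists t, Z t o = k /\ forall s, Z s o = k -> s = t
  | W12 => forall t, Z t o <> k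
  end.

Definition S_count (w : walk_kind) {T : Type} (Z : nat -> T -> nat)
  (n : nat) (o : T) : R :=
  \sum_(2 <= k < n.+1) \1_[set o' | cutpoint w Z k o'] o.

Definition a_seq (q p1 p2 : nat -> R) (k : nat) : R := (p1 k + p2 k) / q k.
Definition b_seq (q p2 : nat -> R) (k : nat) : R := p2 k / q k.
Definition rho (q p1 p2 : nat -> R) (k : nat) : R :=
  (a_seq q p1 p2 k + Num.sqrt (a_seq q p1 p2 k ^+ 2 + 4 * b_seq q p2 k)) / 2.

(* r_n for n >= 4, and r_2 = r_3 = r_4 (r_0, r_1 are irrelevant) *)
Definition r_seq (beta : R) (n : nat) : R :=
  let m := maxn n 4 in
  3^-1 * (m%:R^-1 + (m%:R * (ln (ln m%:R)) `^ beta)^-1).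

End Defs.

(* Main.v *)
Require Import Defs.
From HB Require Import structures.
From mathcomp Require Import all_boot all_order all_algebra.
From mathcomp Require Import all_classical all_reals all_analysis.
From mathcomp Require Import measurable_realfun ring lra zify.
Set Implicit Arguments.
Unset Strict Implicit.
Unset Printing Implicit Defensive.
Import Order.TTheory GRing.Theory Num.Theory.
Import numFieldNormedType.Exports.
Local Open Scope classical_set_scope.
Local Open Scope ring_scope.

(* A site [k] is a cutpoint when the walk, at its first passage above [k], never
   returns to [0, k] (up to a bridge of bounded length, needed because the walk jumps by two).
   The escape probability from [k + 1] is compared with differences of explicit
   sub- and supersolutions [h(n) = d(k) + ... + d(n)] of the harmonic equation.
   Harmonicity of [h] is a two-step recursion for [d] whose positive root is [rho]
   (or [1 / rho] for the (1,2) walk), so that a quotient [d(n) / d(n - 1)] slightly above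
   (below) this root gives a subsolution (supersolution). With
   [d(n) / d(n - 1) = 1 - 1 / n - 1 / g(n) +- c / n ^ 2] and [g(n) = n (log log n) ^ beta],
   the sequence [g d] decreases to 0 by amounts comparable with [d], hence the escape
   probability is of order [1 / g(k)], and the sum of [1 / g] up to [n] is of order
   [log n / (log log n) ^ beta]. The almost sure bound follows by summing expectations
   along [n = 2 ^ (2 ^ j)] and monotonicity of [S_n]. *)

(** The hypothesis gives only the law of finite paths. The Markov property at a first passage is
    therefore derived by summing over the time and place of passage. Optional stopping is replaced
    by an induction on the number of steps, whose error term is the probability of remaining below a
    level; this decays geometrically. The choice of g is explained by a formal derivative. Write L =
    (log log n)^beta, so that g = n L. If d' / d = - 1 / n - 1 / g, then (g d)' = (n L' - 1) d, and
    n L' is small because L varies slowly. Hence (g d)' is close to - d, the tail sum of d from k on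
    is comparable with g(k) d(k), and the escape probability d(k) / (d(k) + d(k + 1) + ...) is of
    order 1 / g(k). The term c / n ^ 2 absorbs both the error O(r_n ^ 2) in rho and the variation of
    the slope over the sites reached in one step, while it perturbs the increments of g d only by a
    relative amount of order L / n. *)

(** * The Markov property, derived from the law of finite paths *)

Section Markov.
Context {R : realType} {d : measure_display} {T : measurableType d}.
Context (P : probability T R) (w : walk_kind) (q p1 p2 : nat -> R).
Context (Z : nat -> T -> nat).
Hypothesis Zwalk : is_walk w q p1 p2 P Z.
Hypothesis trans_ge0 : forall x y, 0 <= trans w q p1 p2 x y.
Local Notation p := (trans w q p1 p2).

Definition at_time (t : nat) (D : set nat) : set T := [set o | D (Z t o)].

(** Cylinder events on the times before [t], one factor per time. The inductive form lets a
    conditioning event shed its last factor, which is how the path law is reached below. *)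
Inductive past : nat -> set T -> Prop :=
| past0 : past 0 setT
| pastS t H D : past t H -> past t.+1 (H `&` at_time t D).

Definition follows (t : nat) (l : seq nat) : set T :=
  [set o | forall i, (i < size l)%N -> Z (t + i) o = nth 0 l i].

Fixpoint path_weight (x : nat) (l : seq nat) : R :=
  if l is y :: l' then p x y * path_weight y l' else 1.

Lemma path_weightE x l :
  path_weight x l = \prod_(i < size l) p (nth 0 (x :: l) i) (nth 0 (x :: l) i.+1).
Proof.
elim: l x => [|y l IH] x /=; first by rewrite big_ord0.
by rewrite big_ord_recl /= IH.
Qed.

Lemma measurable_at_time t D : measurable (at_time t D).
Proof.
rewrite (_ : at_time t D = \bigcup_(x in D) [set o | Z t o = x]).
  by apply: bigcup_measurable => x _; exact: (Zwalk.1 t x).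
apply/seteqP; split => [ o oD|o [x Dx /= xo]].
  by exists (Z t o).
by rewrite /at_time /= xo.
Qed.

Lemma measurable_past t H : past t H -> measurable H.
Proof.
elim=> [|{}t {}H D _ mH]; first exact: measurableT.
by apply: measurableI => //; exact: measurable_at_time.
Qed.

Lemma follows_nil t : follows t [::] = setT.
Proof. by apply/seteqP; split. Qed.

Lemma follows_cons t x l :
  follows t (x :: l) = at_time t [set x] `&` follows t.+1 l.
Proof.
apply/seteqP; split => [ o h|o [hx hl]].
- split; first by have := h 0%N isT; rewrite addn0.
  by move=> i il; have := h i.+1 il; rewrite addnS.
- by move=> [|i] //= il; [rewrite addn0|rewrite addnS; exact: hl].
Qed.

Lemma measurable_follows t l : measurable (follows t l).
Proof.
elim: l t => [|x l IH] t; first by rewrite follows_nil.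
rewrite follows_cons; apply: measurableI => //; exact: measurable_at_time.
Qed.

Lemma measure_at_time_split (A : set T) t (D : set nat) : measurable A ->
  P (A `&` at_time t D) =
  (\sum_(y <oo | y \in D) P (A `&` at_time t [set y]))%E.
Proof.
move=> mA; rewrite (_ : A `&` at_time t D =
    \bigcup_(y in D) (A `&` at_time t [set y])).
  rewrite measure_bigcup //.
  - by move=> y _; apply: measurableI => //; exact: measurable_at_time.
  - by move=> i j _ _ [ o [[_ /= <-] [_ /= <-]]].
apply/seteqP; split => [ o [Ao Do]|o [y Dy [Ao /= yo]]].
- by exists (Z t o).
- by split => //=; rewrite /at_time /= yo.
Qed.

(** Induction on the past: fixing the value [y] of the walk at the last past time turns that
    constraint into the first letter of a longer path. At the empty past the law in [is_walk]
    applies. *)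
Lemma past_follows t H : past t H -> forall x l,
  P (H `&` follows t (x :: l)) =
  (P (H `&` at_time t [set x]) * (path_weight x l)%:E)%E.
Proof.
elim=> [|{}t {}H D pH IH] x l.
- rewrite !setTI.
  have law m : P (follows 0 (x :: m)) =
      ((if x == 2%N then 1 else 0) * path_weight x m)%:E.
    rewrite path_weightE -(Zwalk.2 (size m) (fun i => nth 0 (x :: m) i)).
    by congr (P _); apply/seteqP; split => o h i im; exact: (h i im).
  have -> : at_time 0 [set x] = follows 0 [:: x].
    by rewrite follows_cons follows_nil setIT.
  by rewrite !law /= mulr1 EFinM.
- have mH := measurable_past pH.
  have swap B : H `&` at_time t D `&` B = (H `&` B) `&` at_time t D.
    by rewrite setIAC.
  rewrite !swap !measure_at_time_split; first last.
  + by apply: measurableI => //; exact: measurable_follows.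
  + by apply: measurableI => //; exact: measurable_at_time.
  rewrite muleC -nneseriesZl; last by move=> *; exact: measure_ge0.
  apply: eq_eseriesr => y _.
  have e m : H `&` follows t.+1 m `&` at_time t [set y] =
      H `&` follows t (y :: m).
    by rewrite follows_cons (setIC (at_time _ _)) setIA.
  rewrite e (_ : at_time t.+1 [set x] = follows t.+1 [:: x]); last first.
    by rewrite follows_cons follows_nil setIT.
  rewrite e !IH /= mulr1 EFinM.
  by rewrite muleCA muleA muleC [in RHS]muleC muleA muleC muleAC muleA.
Qed.

Lemma past_step t H x y : past t H ->
  P (H `&` at_time t [set x] `&` at_time t.+1 [set y]) =
  (P (H `&` at_time t [set x]) * (p x y)%:E)%E.
Proof.
move=> pH; have := past_follows pH x [:: y].
by rewrite !follows_cons follows_nil setIT setIA /= mulr1.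
Qed.

(** The chance that the chain started at [x] is in [G] at all times from 0 to [m], given by
    first-step analysis without reference to [P]. The highest state reachable in one step is
    [x + 2]. *)
Fixpoint stay_prob (G : pred nat) (m x : nat) : R :=
  if m is m'.+1 then
    if G x then \sum_(y < x.+3) p x y * stay_prob G m' y else 0
  else (G x)%:R.

Lemma stay_prob_ge0 G m x : 0 <= stay_prob G m x.
Proof.
elim: m x => [|m IH] x /=; first by [].
by case: ifP => // _; apply: sumr_ge0 => y _; rewrite mulr_ge0.
Qed.

Lemma trans_far x y : (x.+3 <= y)%N -> p x y = 0.
Proof.
rewrite /trans => h.
case: w; do ![case: ifPn => [/eqP ?|_] ]; first [by [] | lia].
Qed.

Definition stays (t : nat) (G : pred nat) (m : nat) : set T :=
  [set o | forall i, (i <= m)%N -> G (Z (t + i) o)].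

Lemma stays0 t G : stays t G 0 = at_time t [set` G].
Proof.
apply/seteqP; split => [ o /(_ 0%N isT)|o h i]; first by rewrite addn0.
by rewrite leqn0 => /eqP ->; rewrite addn0.
Qed.

Lemma staysS t G m : stays t G m.+1 = at_time t [set` G] `&` stays t.+1 G m.
Proof.
apply/seteqP; split => [ o h|o [h0 h]].
- split; first by have := h 0%N isT; rewrite addn0.
  by move=> i im; rewrite addSnnS; apply: h.
- by case=> [|i] im; [rewrite addn0|rewrite -addSnnS; apply: h].
Qed.

Lemma measurable_stays t G m : measurable (stays t G m).
Proof.
elim: m t => [|m IH] t; rewrite ?stays0 ?staysS; first exact: measurable_at_time.
by apply: measurableI => //; exact: measurable_at_time.
Qed.

Lemma past_stays t H G m x : past t H ->
  P (H `&` at_time t [set x] `&` stays t G m) =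
  (P (H `&` at_time t [set x]) * (stay_prob G m x)%:E)%E.
Proof.
have at_in s A D : ~ D x -> P (A `&` at_time s [set x] `&` at_time s D) = 0%E.
  move=> nD; rewrite (_ : _ `&` _ `&` _ = set0) ?measure0 //.
  by apply/seteqP; split => // o [[_ e]]; rewrite /at_time /mkset; move: e => /= ->.
have at_id s A (D : set nat) : D x ->
    A `&` at_time s [set x] `&` at_time s D = A `&` at_time s [set x].
  by move=> xD; apply/setIidl => o [_ e]; rewrite /at_time /mkset; move: e => /= ->.
elim: m t H x at_in at_id => [|m IH] t H x at_in at_id pH.
  rewrite stays0 /=; case: (boolP (G x)) => [Gx|/negP nGx]; first by rewrite mule1 at_id.
  by rewrite mule0 at_in.
rewrite staysS setIA /=; case: ifPn => Gx; last first.
  apply/eqP; rewrite mule0 eq_le measure_ge0 andbT.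
  rewrite -(at_in t H [set` G]); last by rewrite /mkset; exact/negP.
  have mH := measurable_past pH.
  apply: le_measure; rewrite ?inE; last by move=> o [].
  - by apply: measurableI; [apply: measurableI;[apply: measurableI|]|];
      rewrite ?mH //; do ?exact: measurable_at_time; exact: measurable_stays.
  - by apply: measurableI; [apply: measurableI|];
      do ?exact: measurable_at_time.
rewrite at_id //.
set H' := H `&` at_time t [set x].
have pH' : past t.+1 H' by exact: pastS.
have mH' := measurable_past pH'.
have -> : H' `&` stays t.+1 G m = H' `&` stays t.+1 G m `&` at_time t.+1 setT.
  by rewrite [at_time _ setT](_ : _ = setT) ?setIT //; apply/seteqP; split.
rewrite measure_at_time_split; last first.
  by apply: measurableI => //; exact: measurable_stays.
rewrite (eq_eseriesl (Q := predT)); last by move=> i; rewrite in_setT.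
under eq_eseriesr => y _.
  rewrite setIAC IH //; last 2 first.
  - move=> s A D nD; rewrite (_ : _ `&` _ `&` _ = set0) ?measure0 //.
    by apply/seteqP; split => // o [[_ e]]; rewrite /at_time /mkset; move: e => /= ->.
  - by move=> s A D xD; apply/setIidl => o [_ e]; rewrite /at_time /mkset; move: e => /= ->.
  rewrite past_step // -muleA -EFinM.
  over.
(* No jump exceeds two, so the series over the next state reduces to the finite sum in
   [stay_prob]. *)
have tail0 : (\sum_(0 + x.+3 <= y <oo)
    (P (H `&` at_time t [set x]) * (p x y * stay_prob G m y)%:E) = 0)%E.
  apply: eseries0 => y xy _; rewrite trans_far ?mul0r ?mule0 //.
rewrite (nneseries_split _ x.+3); last first.
  by move=> y _; rewrite mule_ge0 // lee_fin mulr_ge0 // stay_prob_ge0.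
rewrite tail0 adde0 add0n big_mkord -ge0_sume_distrr ?sumEFin //.
by move=> y _; rewrite lee_fin mulr_ge0 // stay_prob_ge0.
Qed.
End Markov.

(** * First-passage decomposition and almost sure properties of paths *)

Section Passage.
Context {R : realType} {d : measure_display} {T : measurableType d}.
Context (P : probability T R) (w : walk_kind) (q p1 p2 : nat -> R).
Context (Z : nat -> T -> nat).
Hypothesis Zwalk : is_walk w q p1 p2 P Z.
Hypothesis trans_ge0 : forall x y, 0 <= trans w q p1 p2 x y.
Local Notation p := (trans w q p1 p2).
Local Notation at_time := (at_time Z).
Local Notation follows := (follows Z).
Local Notation stays := (stays Z).
Local Notation past := (past Z).
Local Notation stay_prob := (stay_prob w q p1 p2).

Lemma at_timeT t : at_time t setT = setT.
Proof. by apply/seteqP; split. Qed.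

Lemma past_setT t : past t setT.
Proof.
elim: t => [|t IH]; first exact: past0.
by have := pastS setT IH; rewrite at_timeT setIT.
Qed.

Definition below (N t : nat) : set T := [set o | forall i, (i < t)%N -> (Z i o < N)%N].

Lemma past_below N t : past t (below N t).
Proof.
elim: t => [|t IH].
  by rewrite (_ : below N 0 = setT); [exact: past0|apply/seteqP; split].
rewrite (_ : below N t.+1 = below N t `&` at_time t [set x | (x < N)%N]).
  exact: pastS.
apply/seteqP; split => [ o h| o [h1 h2] i].
- by split => [i it|]; apply: h => //; apply: ltnW.
- by rewrite ltnS leq_eqVlt => /orP[/eqP ->|/h1].
Qed.

Lemma past_followed t H l : past t H -> past (t + size l) (H `&` follows t l).
Proof.
elim: l t H => [|x l IH] t H pH; first by rewrite follows_nil setIT addn0.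
by rewrite follows_cons setIA /= -addSnnS; apply: IH; exact: pastS.
Qed.

Lemma follows_rcons t l y :
  follows t (rcons l y) = follows t l `&` at_time (t + size l) [set y].
Proof.
elim: l t => [|x l IH] t /=; last by rewrite !follows_cons IH setIA addnS addSn.
by rewrite follows_cons !follows_nil addn0 setIC.
Qed.

Lemma past_follows_stays t H x l G m : past t H ->
  P (H `&` follows t (x :: l) `&` stays (t + size l) G m) =
  (P (H `&` at_time t [set x]) *
   (path_weight w q p1 p2 x l * stay_prob G m (last x l))%:E)%E.
Proof.
move=> pH; have pF := past_followed (belast x l) pH.
rewrite size_belast in pF.
have e : follows t (x :: l) =
    follows t (belast x l) `&` at_time (t + size l) [set last x l].
  by rewrite lastI follows_rcons size_belast.
rewrite e setIA (past_stays Zwalk trans_ge0 _ _ _ pF) -setIA -e.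
by rewrite (past_follows Zwalk pH) -muleA -EFinM.
Qed.

Lemma le_measure_negligible (A B : set T) (N : set T) :
  measurable A -> measurable B -> P.-negligible N -> A `<=` B `|` N ->
  (P A <= P B)%E.
Proof.
move=> mA mB [M [mM M0 NM]] AB.
apply: (@le_trans _ _ (P (B `|` M))).
  apply: le_measure; rewrite ?inE //; first exact: measurableU.
  by move=> o /AB [|/NM]; [left|right].
have := measureU2 P mB mM; rewrite [X in (_ + X)%E](_ : _ = 0%E) ?adde0 //.
Qed.

(** Supplied later by the geometric decay in [stay_below_geometric]. *)
Hypothesis exits : forall N x eps, 0 < eps ->
  exists m, stay_prob [pred y | y < N]%N m x <= eps.

(** The state at time [t] splits the event into countably many pieces, each of probability at most
    [stay_prob] for every number of steps, hence null by [exits]. *)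
Lemma negligible_confined N t :
  P.-negligible [set o | forall i, (Z (t + i) o < N)%N].
Proof.
rewrite (_ : mkset _ = \bigcup_x (at_time t [set x] `&`
    [set o | forall i, (Z (t + i) o < N)%N])); last first.
  by apply/seteqP; split => [ o h| o [x _ []//]]; exists (Z t o).
apply: negligible_bigcup => x; set G := [pred y | y < N]%N.
set B := _ `&` _.
have BE : B = at_time t [set x] `&` \bigcap_m (stays t G m).
  apply/seteqP; split => [ o [h1 h2]| o [h1 h2]]; split => //.
  - by move=> m _ i _; exact: h2.
  - by move=> i; apply: (h2 i I).
have mB : measurable B.
  rewrite BE; apply: measurableI; first exact: (measurable_at_time Zwalk).
  by apply: bigcap_measurable => // m _; exact: (measurable_stays Zwalk).
exists B; split => //; apply/eqP; rewrite eq_le measure_ge0 andbT.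
apply/lee_addgt0Pr => e e0; rewrite add0e.
have [m hm] := exits N x e0.
have := past_stays Zwalk trans_ge0 G m x (past_setT t); rewrite !setTI => st.
apply: (@le_trans _ _ (P (at_time t [set x] `&` stays t G m))).
  apply: le_measure; rewrite ?inE //.
    by apply: measurableI; [exact: (measurable_at_time Zwalk)|
                            exact: (measurable_stays Zwalk)].
  by rewrite BE => o [h1 h2]; split => //; exact: h2.
rewrite st -[leRHS]mul1e lee_pmul ?lee_fin //.
- by apply: stay_prob_ge0 => *; exact: trans_ge0.
- by apply: probability_le1; exact: (measurable_at_time Zwalk).
Qed.

(** The almost sure properties of a path that the combinatorics of cutpoints uses; they allow
    arguments on a single trajectory [z]. *)
Definition regular (z : nat -> nat) : Prop :=
  [/\ z 0%N = 2%N, forall t, p (z t) (z t.+1) <> 0 &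
      forall N t, exists2 s, (t <= s)%N & (N <= z s)%N].

Lemma negligible_irregular : P.-negligible [set o | ~ regular (Z ^~ o)].
Proof.
have n1 : P.-negligible (\bigcup_(x in [set x | x <> 2%N]) at_time 0 [set x]).
  rewrite bigcup_mkcond; apply: negligible_bigcup => x; case: ifPn; last first.
    by move=> _; exact: negligible_set0.
  rewrite inE /= => /eqP x2; exists (at_time 0 [set x]); split => //.
    exact: (measurable_at_time Zwalk).
  have := Zwalk.2 0%N (fun=> x); rewrite big_ord0 (negPf x2) mul0r => law.
  apply: etrans law; congr (P _); apply/seteqP; split => [ o h [|//] _| o h] //.
  exact: (h 0%N).
have n2 : P.-negligible (\bigcup_t \bigcup_x \bigcup_(y in [set y | p x y = 0])
    (at_time t [set x] `&` at_time t.+1 [set y])).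
  apply: negligible_bigcup => t; apply: negligible_bigcup => x.
  rewrite bigcup_mkcond; apply: negligible_bigcup => y; case: ifPn; last first.
    by move=> _; exact: negligible_set0.
  rewrite inE /= => xy; have mt := measurable_at_time Zwalk.
  exists (at_time t [set x] `&` at_time t.+1 [set y]); split => //.
    exact: measurableI.
  have := past_step Zwalk x y (past_setT t).
  by rewrite !setTI xy mule0.
have n3 : P.-negligible (\bigcup_N \bigcup_t
    [set o | forall i, (Z (t + i) o < N)%N]).
  apply: negligible_bigcup => N; apply: negligible_bigcup => t.
  exact: negligible_confined.
apply: negligibleS (negligibleU n1 (negligibleU n2 n3)) => o /= nr.
apply: contrapT => nU; apply: nr; split.
- apply: contrapT => x2; apply: nU; left; exists (Z 0%N o) => //.
- move=> t p0; apply: nU; right; left.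
  by exists t => //; exists (Z t o) => //; exists (Z t.+1 o).
- move=> N t; apply: contrapT => ns; apply: nU; right; right.
  exists N => //; exists t => // i; rewrite ltnNge; apply/negP => Ni.
  by apply: ns; exists (t + i)%N => //; exact: leq_addr.
Qed.

Definition entry (N t x : nat) : set T := below N t `&` at_time t [set x].

Lemma measurable_entry N t x : measurable (entry N t x).
Proof.
apply: measurableI; last exact: (measurable_at_time Zwalk).
exact: (measurable_past Zwalk (past_below N t)).
Qed.

(** The events [entry N t x] with [N <= x] are disjoint, since an earlier entry contradicts [below],
    and they cover all regular paths. *)
Lemma measure_entry_split (N : nat) (X : pred nat) (E : set T) :
  measurable E -> {in X, forall x, N <= x}%N ->
  (forall z, regular z ->
    exists t, (forall i, (i < t)%N -> (z i < N)%N) /\ X (z t)) ->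
  P E = (\sum_(t <oo) \sum_(x <oo | x \in [set` X]) P (E `&` entry N t x))%E.
Proof.
move=> mE XN ent.
have mEe t x : measurable (E `&` entry N t x).
  by apply: measurableI => //; exact: measurable_entry.
pose A t := \bigcup_(x in [set` X]) (E `&` entry N t x).
have mA t : measurable (A t) by apply: bigcup_measurable.
have PA t : P (A t) = (\sum_(x <oo | x \in [set` X]) P (E `&` entry N t x))%E.
  rewrite measure_bigcup //.
  by move=> i j _ _ [ o [[_ [_ /= <-]] [_ [_ /= <-]]]].
have before t1 t2 o : A t1 o -> A t2 o -> ~ (t1 < t2)%N.
  move=> [x1 Xx1 [_ [_ z1]]] [x2 _ [_ [lt2 _]]] /lt2.
  move: z1 => /= ->; by rewrite ltnNge XN.
have -> : P E = P (\bigcup_t A t).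
  apply/eqP; rewrite eq_le; apply/andP; split.
    apply: le_measure_negligible negligible_irregular _ => //.
      exact: bigcupT_measurable.
    move=> o Eo; have [r|] := pselect (regular (Z ^~ o)); last by right.
    have [t [bt Xt]] := ent _ r; left; exists t => //; exists (Z t o) => //.
  apply: le_measure; rewrite ?inE //; first exact: bigcupT_measurable.
  by move=> o [t _ [x _ []]].
rewrite measure_bigcup //; last first.
  move=> t1 t2 _ _ [ o [A1 A2]]; apply/eqP; rewrite eqn_leq.
  by apply/andP; split; rewrite leqNgt; apply/negP; apply: before A1 || apply: before A2.
rewrite (eq_eseriesl (Q := predT)) => [|i]; last by rewrite in_setT.
by apply: eq_eseriesr => t _; exact: PA.
Qed.

(** This plays the role of the strong Markov property. The decomposition applied to the whole space
    shows that the weights [P (entry N t x)] sum to 1, so a bound conditional on each entry passes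
    to [E]. *)
Lemma measure_entry_le (N : nat) (X : pred nat) (E : set T) (v : R) :
  measurable E -> 0 <= v -> {in X, forall x, N <= x}%N ->
  (forall z, regular z ->
    exists t, (forall i, (i < t)%N -> (z i < N)%N) /\ X (z t)) ->
  (forall t x, X x -> (P (E `&` entry N t x) <= v%:E * P (entry N t x))%E) ->
  (P E <= v%:E)%E.
Proof.
move=> mE v0 XN ent le; rewrite (measure_entry_split mE XN ent).
have P1 : P setT = 1%E by exact: probability_setT.
rewrite -[leRHS]mule1 -P1 (measure_entry_split _ XN ent) //.
rewrite -nneseriesZl; last by move=> t _; apply: nneseries_ge0 => *; exact: measure_ge0.
apply: lee_nneseries => [t _ _|t _]; first by apply: nneseries_ge0 => *; exact: measure_ge0.
rewrite -nneseriesZl //.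
apply: lee_nneseries => [x _ _|x]; first exact: measure_ge0.
by rewrite inE => Xx; rewrite setTI le.
Qed.

Lemma measure_entry_ge (N : nat) (X : pred nat) (E : set T) (v : R) :
  measurable E -> 0 <= v -> {in X, forall x, N <= x}%N ->
  (forall z, regular z ->
    exists t, (forall i, (i < t)%N -> (z i < N)%N) /\ X (z t)) ->
  (forall t x, X x -> (v%:E * P (entry N t x) <= P (E `&` entry N t x))%E) ->
  (v%:E <= P E)%E.
Proof.
move=> mE v0 XN ent le; rewrite (measure_entry_split mE XN ent).
have P1 : P setT = 1%E by exact: probability_setT.
rewrite -[leLHS]mule1 -P1 (measure_entry_split _ XN ent) //.
rewrite -nneseriesZl; last by move=> t _; apply: nneseries_ge0 => *; exact: measure_ge0.
apply: lee_nneseries => [t _ _|t _]; first by rewrite mule_ge0 ?lee_fin //;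
  apply: nneseries_ge0 => *; exact: measure_ge0.
rewrite -nneseriesZl //.
apply: lee_nneseries => [x _ _|x]; first by rewrite mule_ge0 ?lee_fin.
by rewrite inE => Xx; rewrite setTI le.
Qed.

End Passage.

(** * The one-step operator, comparison principles and exit from bounded sets *)

Section Kernel.
Context {R : realType} (w : walk_kind) (q p1 p2 : nat -> R).
Hypothesis prob_params : forall k, (2 <= k)%N ->
  0 < q k /\ 0 <= p1 k /\ 0 < p2 k /\ q k + p1 k + p2 k = 1.
Local Notation p := (trans w q p1 p2).
Local Notation stay_prob := (stay_prob w q p1 p2).

Lemma trans_ge0 x y : 0 <= p x y.
Proof.
have qp k : k != 0%N -> k != 1%N -> [/\ 0 <= q k, 0 <= p1 k & 0 <= p2 k].
  move=> k0 k1; have [|h1 [h2 [h3 _]]] := @prob_params k; first by lia.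
  by split => //; exact: ltW.
rewrite /trans; case: w.
- case: eqP => [_|/eqP x0]; first by case: ifP.
  case: eqP => [_|/eqP x1]; first by case: ifP.
  by have [] := qp _ x0 x1; do ![case: ifP => //].
- case: eqP => [_|/eqP x1]; first by case: ifP.
  case: eqP => [_|/eqP x0]; first by case: ifP.
  by have [] := qp _ x0 x1; do ![case: ifP => //].
Qed.

Definition mean_step (f : nat -> R) (x : nat) : R := \sum_(y < x.+3) p x y * f y.

Definition up_down (f : nat -> R) (n : nat) : R :=
  match w with
  | W21 => q n.+2 * f n.+3 + p1 n.+2 * f n.+1 + p2 n.+2 * f n
  | W12 => q n.+2 * f n.+1 + p1 n.+2 * f n.+3 + p2 n.+2 * f n.+4
  end.

Lemma mean_step0 f : mean_step f 0 = if w is W21 then f 1%N else f 2%N.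
Proof.
by rewrite /mean_step 3!big_ord_recr big_ord0 /trans /=; case: w => /=;
  rewrite !mul0r mul1r ?add0r ?addr0.
Qed.

Lemma mean_step1 f : mean_step f 1 = if w is W21 then f 2%N else f 0%N.
Proof.
by rewrite /mean_step 4!big_ord_recr big_ord0 /trans /=; case: w => /=;
  rewrite !mul0r mul1r ?add0r ?addr0.
Qed.

Lemma mean_stepE f n : mean_step f n.+2 = up_down f n.
Proof.
rewrite /mean_step 5!big_ord_recr /= big1 => [|[i /= ilt] _]; last first.
  rewrite /trans; case: w => /=; rewrite !ifF ?mul0r //; apply/eqP; lia.
rewrite add0r /up_down /trans; case: w => /=; rewrite ?eqxx.
- have -> : (n == n.+3) = false by lia.
  have -> : (n == n.+1) = false by lia.
  have -> : (n.+1 == n.+3) = false by lia.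
  have -> : (n.+2 == n.+3) = false by lia.
  have -> : (n.+2 == n.+1) = false by lia.
  have -> : (n.+2 == n) = false by lia.
  have -> : (n.+4 == n.+3) = false by lia.
  have -> : (n.+4 == n.+1) = false by lia.
  have -> : (n.+4 == n) = false by lia.
  ring.
- have -> : (n == n.+1) = false by lia.
  have -> : (n == n.+3) = false by lia.
  have -> : (n == n.+4) = false by lia.
  have -> : (n.+2 == n.+1) = false by lia.
  have -> : (n.+2 == n.+3) = false by lia.
  have -> : (n.+2 == n.+4) = false by lia.
  have -> : (n.+3 == n.+1) = false by lia.
  have -> : (n.+4 == n.+1) = false by lia.
  have -> : (n.+4 == n.+3) = false by lia.
  ring.
Qed.

Lemma mean_step_cst c x : mean_step (fun=> c) x = c.
Proof.
case: x => [|[|n]]; rewrite ?mean_step0 ?mean_step1 ?mean_stepE.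
- by case: w.
- by case: w.
- have [_ [_ [_ e]]] := @prob_params n.+2 isT.
  by rewrite /up_down; case: w; rewrite -[RHS]mul1r -e; ring.
Qed.

Lemma le_mean_step f g x : (forall y, (y < x.+3)%N -> f y <= g y) ->
  mean_step f x <= mean_step g x.
Proof.
move=> fg; apply: ler_sum => y _; apply: ler_wpM2l; first exact: trans_ge0.
exact: fg.
Qed.

Lemma mean_step_ge0 f x : (forall y, 0 <= f y) -> 0 <= mean_step f x.
Proof. by move=> f0; apply: sumr_ge0 => y _; rewrite mulr_ge0 // trans_ge0. Qed.

Lemma mean_stepD f g x :
  mean_step (fun y => f y + g y) x = mean_step f x + mean_step g x.
Proof. by rewrite -big_split; apply: eq_bigr => y _ /=; rewrite mulrDr. Qed.

Lemma mean_stepZ c f x : mean_step (fun y => c * f y) x = c * mean_step f x.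
Proof. by rewrite /mean_step mulr_sumr; apply: eq_bigr => y _; rewrite mulrCA. Qed.

Lemma stay_probS G m x :
  stay_prob G m.+1 x = if G x then mean_step (stay_prob G m) x else 0.
Proof. by []. Qed.

Lemma stay_prob_le1 G m x : stay_prob G m x <= 1.
Proof.
elim: m x => [|m IH] x; first by rewrite /= lern1 leq_b1.
rewrite stay_probS; case: ifP => // _.
by rewrite -[leRHS](mean_step_cst 1 x); apply: le_mean_step => y _; exact: IH.
Qed.

(** A walk that stays above [k] for [m] steps either reaches [N], where [h / h N] is at least 1, or
    stays below [N] all along. The supersolution property carries this bound through the induction
    on [m]. *)
Lemma stay_above_le (k N : nat) (h : nat -> R) m x :
  (forall x, 0 <= h x) -> 0 < h N -> (forall x, (N <= x)%N -> h N <= h x) ->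
  (forall x, (k < x < N)%N -> mean_step h x <= h x) ->
  stay_prob [pred y | k < y]%N m x <=
    h x / h N + stay_prob [pred y | y < N]%N m x.
Proof.
move=> h0 hN hmon super.
have far z n : (N <= z)%N -> stay_prob [pred y | k < y]%N n z <=
    h z / h N + stay_prob [pred y | y < N]%N n z.
  move=> Nz; apply: (le_trans (stay_prob_le1 _ _ _)).
  rewrite -[leLHS]addr0 lerD //; last by apply: stay_prob_ge0; exact: trans_ge0.
  by rewrite ler_pdivlMr // mul1r hmon.
elim: m x => [|m IH] x.
  have [/far //|xN] := leqP N x.
  rewrite /= xN; apply: (@le_trans _ _ 1); first by rewrite lern1 leq_b1.
  by rewrite lerDr mulr_ge0 // invr_ge0.
have [/far //|xN] := leqP N x.
rewrite !stay_probS /= xN; case: ifP => [kx|_]; last first.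
  rewrite addr_ge0 ?mulr_ge0 ?invr_ge0 //.
  by apply: mean_step_ge0 => y; apply: stay_prob_ge0; exact: trans_ge0.
apply: (@le_trans _ _ (mean_step (fun y => (h N)^-1 * h y +
    stay_prob [pred y | y < N]%N m y) x)).
  by apply: le_mean_step => y _; rewrite mulrC; exact: IH.
rewrite mean_stepD mean_stepZ lerD2r mulrC ler_wpM2r ?invr_ge0 //.
by apply: super; rewrite kx.
Qed.

(** At [m = 0] the function [h] lies below the indicator of the sites above [k], and a subsolution
    stays below under the first-step recursion. As [h <= 1] everywhere, no upper barrier enters. *)
Lemma stay_above_ge (k : nat) (h : nat -> R) m x :
  (forall x, h x <= 1) -> (forall x, (x <= k)%N -> h x <= 0) ->
  (forall x, (k < x)%N -> h x <= mean_step h x) ->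
  h x <= stay_prob [pred y | k < y]%N m x.
Proof.
move=> h1 h0 sub; elim: m x => [|m IH] x /=.
  by have [kx|/h0 //] := ltnP k x.
case: ifP => [kx|/negbT]; last by rewrite -leqNgt => /h0.
by apply: le_trans (sub _ kx) _; apply: le_mean_step => y _; exact: IH.
Qed.

(** Provides the base [l] of the exponential in [doubling_function]: finitely many positive
    probabilities are all at least [2 / l]. *)
Lemma uniform_bound (N : nat) : exists l : R, 2 <= l /\
  forall k, (2 <= k < N)%N -> 2 <= l * q k /\ 2 <= l * p2 k.
Proof.
elim: N => [|N [l [l2 IH]]]; first by exists 2; split => // k; rewrite ltn0 andbF.
have [N2|N2] := ltnP N 2.
  by exists l; split => // k /andP[k2 kN]; apply: IH; rewrite k2 /=; lia.
have [qN [_ [pN _]]] := prob_params N2.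
have iq : 0 <= 2 / q N by rewrite divr_ge0 // ltW.
have ip : 0 <= 2 / p2 N by rewrite divr_ge0 // ltW.
exists (l + 2 / q N + 2 / p2 N); split => [|k /andP[k2]]; first by lra.
have [qk [_ [pk _]]] := prob_params k2.
rewrite ltnS leq_eqVlt => /orP[/eqP ->|kN].
- rewrite ![(l + _ + _) * _]mulrDl ![(l + _) * _]mulrDl !divfK ?gt_eqF //; split.
  + by rewrite addrAC lerDr; apply: addr_ge0; apply: mulr_ge0 => //; first [exact: ltW | lra].
  + by rewrite lerDr; apply: addr_ge0; apply: mulr_ge0 => //; first [exact: ltW | lra].
- have [|a b] := IH k; first by rewrite k2.
  by split; rewrite ![(l + _ + _) * _]mulrDl ![(l + _) * _]mulrDl -addrA;
    [apply: (le_trans a)|apply: (le_trans b)];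
    rewrite lerDl; apply: addr_ge0; apply: mulr_ge0 => //; exact: ltW.
Qed.

(* For the (1,2) walk the value 1/2 at 1 compensates the forced step from 1 to 0. *)
Lemma doubling_function (N : nat) : exists f : nat -> R,
  (forall x, 2^-1 <= f x) /\ (forall x, (x < N)%N -> 2 * f x <= mean_step f x).
Proof.
have [l [l2 big_l]] := uniform_bound N.
have l1 : 1 <= l by lra.
have X1 n : 1 <= l ^+ n by exact: exprn_ege1.
have X0 n : 0 <= l ^+ n by apply: le_trans (X1 n).
exists (fun x => if w is W12 then if x == 1%N then 2^-1 else l ^+ x else l ^+ x).
split => [x|[|[|n]] xN].
- by case: w; [|case: ifP => // _]; have := X1 x; lra.
- by rewrite mean_step0; case: w; rewrite /= ?expr0 ?expr1 ?expr2 //; nra.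
- by rewrite mean_step1; case: w; rewrite /= ?expr0 ?expr1 ?expr2 //; nra.
- have [qn [p1n [pn _]]] := @prob_params n.+2 isT.
  have [bq bp] := big_l n.+2 xN.
  have [e2 e3 e4 e1] : [/\ (n.+2 == 1%N) = false, (n.+3 == 1%N) = false,
    (n.+4 == 1%N) = false & 0 <= (if n.+1 == 1%N then 2^-1 else l ^+ n.+1 : R)].
    by split => //; case: ifP => // _; lra.
  rewrite mean_stepE /up_down; case: w; lazy beta iota; rewrite ?e2 ?e3 ?e4.
  + apply: (@le_trans _ _ (q n.+2 * l ^+ n.+3)).
      by rewrite [l ^+ n.+3]exprS mulrA ler_wpM2r // mulrC.
    by rewrite -addrA lerDl; apply: addr_ge0; apply: mulr_ge0 => //; exact: ltW.
  + apply: (@le_trans _ _ (p2 n.+2 * l ^+ n.+4)).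
      have -> : l ^+ n.+4 = l * l * l ^+ n.+2 by rewrite -mulrA -!exprS.
      rewrite mulrA; apply: ler_wpM2r; first exact: (X0 n.+2).
      rewrite [p2 _ * _]mulrC -mulrA; apply: (le_trans bp); rewrite ler_peMl //; lra.
    rewrite lerDr; apply: addr_ge0; apply: mulr_ge0 => //; exact: ltW.
Qed.

Lemma stay_below_geometric (N : nat) : exists K th : R,
  [/\ 0 <= K, 0 <= th, th < 1 & forall m x, (x < N.+3)%N ->
    stay_prob [pred y | y < N]%N m x <= th ^+ m * K].
Proof.
have [f [f_ge dbl]] := doubling_function N.
have f0 x : 0 <= f x by apply: le_trans (f_ge x).
pose K : R := 1 + \sum_(x < N.+3) f x.
have fK x : (x < N.+3)%N -> f x <= K - 1.
  move=> xN; rewrite /K addrAC subrr add0r.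
  by rewrite (bigD1 (Ordinal xN)) //= lerDl sumr_ge0.
have K1 : 1 <= K by rewrite /K lerDl sumr_ge0.
pose th : R := 1 - (2 * K)^-1.
have iK0 : 0 < (2 * K)^-1 by rewrite invr_gt0; lra.
have iK1 : (2 * K)^-1 <= 2^-1 by rewrite lef_pV2 ?posrE; lra.
have thK : th * K = K - 2^-1.
  by rewrite /th mulrBl mul1r invfM -mulrA mulVf ?mulr1 // gt_eqF //; lra.
have th0 : 0 <= th by rewrite /th; lra.
have th1 : th < 1 by rewrite /th; lra.
exists K, th; split => //; first by lra.
suff H m x : (x < N.+3)%N -> stay_prob [pred y | y < N]%N m x <= th ^+ m * (K - f x).
  move=> m x xN; apply: (le_trans (H m x xN)); apply: ler_wpM2l.
    exact: exprn_ge0.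
  by rewrite lerBlDr lerDl.
elim: m x => [|m IH] x xN.
  rewrite expr0 mul1r; have := fK _ xN => /= h.
  by apply: (@le_trans _ _ 1); [rewrite lern1 leq_b1|lra].
rewrite stay_probS /=; case: ifP => [xN'|_]; last first.
  by rewrite mulr_ge0 ?exprn_ge0 //; have := fK _ xN; lra.
apply: (@le_trans _ _ (mean_step (fun y => th ^+ m * (K + (-1) * f y)) x)).
  apply: le_mean_step => y yx; rewrite mulN1r; apply: IH.
  by apply: (leq_trans yx); lia.
rewrite mean_stepZ mean_stepD mean_stepZ mean_step_cst exprS -mulrA [leRHS]mulrCA.
apply: ler_wpM2l; first exact: exprn_ge0.
rewrite mulrBr thK; have := dbl _ xN'; have := f_ge x; have := f0 x.
have : th * f x <= f x by rewrite ler_piMl // ltW.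
lra.
Qed.

Lemma stay_below_small (N : nat) (eps : R) : 0 < eps ->
  exists m, forall x, stay_prob [pred y | y < N]%N m x <= eps.
Proof.
move=> e0; have [K [th [K0 th0 th1 H]]] := stay_below_geometric N.
have : (fun m => th ^+ m * K) @ \oo --> (0 * K : R).
  by apply: cvgMl; apply: cvg_expr; rewrite ger0_norm.
rewrite mul0r => /cvgrPdist_le /(_ _ e0) [m _ /(_ m.+1 (leqnSn m))] /=.
rewrite sub0r normrN ger0_norm ?mulr_ge0 ?exprn_ge0 // => h.
exists m.+1 => x; have [xN|Nx] := ltnP x N.+3.
  by apply: le_trans h; exact: H.
by rewrite stay_probS /= ifF ?ltW //; lia.
Qed.
End Kernel.

(** * From escape probabilities to cutpoint probabilities *)

Section Cutpoints.
Context {R : realType} {d : measure_display} {T : measurableType d}.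
Context (P : probability T R) (w : walk_kind) (q p1 p2 : nat -> R).
Context (Z : nat -> T -> nat).
Hypothesis Zwalk : is_walk w q p1 p2 P Z.
Hypothesis prob_params : forall k, (2 <= k)%N ->
  0 < q k /\ 0 <= p1 k /\ 0 < p2 k /\ q k + p1 k + p2 k = 1.
Local Notation p := (trans w q p1 p2).
Local Notation regular := (regular w q p1 p2).
Local Notation stay_prob := (stay_prob w q p1 p2).
Let p_ge0 := trans_ge0 w prob_params.
Let exits N x eps : 0 < eps -> exists m, stay_prob [pred y | y < N]%N m x <= eps.
Proof.
by move=> e0; have [m] := stay_below_small w prob_params N e0; exists m.
Qed.

Lemma regular_jump z t : regular z -> (z t.+1 <= z t + 2)%N.
Proof.
case=> _ pz _; rewrite leqNgt; apply/negP => h; apply: (pz t).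
by apply: trans_far; rewrite addn2 in h.
Qed.

Lemma regular_up z t : w = W21 -> regular z -> (z t.+1 <= z t + 1)%N.
Proof.
move=> wE [_ pz _]; rewrite leqNgt; apply/negP => h; apply: (pz t).
rewrite /trans wE; do ![case: ifP => [/eqP ?|_] ]; first [by [] | lia].
Qed.

Lemma regular_down z t : w = W12 -> regular z -> (z t <= z t.+1 + 1)%N.
Proof.
move=> wE [_ pz _]; rewrite leqNgt; apply/negP => h; apply: (pz t).
rewrite /trans wE; do ![case: ifP => [/eqP ?|_] ]; first [by [] | lia].
Qed.

(** Since [z 0 = 2 < N], the entry time is positive, and the preceding state below [N] limits the
    overshoot to the largest upward jump minus one. *)
Lemma regular_entry z N : (3 <= N)%N -> regular z ->
  exists t, (forall i, (i < t)%N -> (z i < N)%N) /\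
    (N <= z t <= N + (if w is W21 then 0 else 1))%N.
Proof.
move=> N3 rz; have [z0 _ ez] := rz.
have ex : exists t, (N <= z t)%N by have [s _ Ns] := ez N 0%N; exists s.
case: (ex_minnP ex) => t Nt tmin; exists t; split.
  by move=> i it; rewrite ltnNge; apply/negP => /tmin; rewrite leqNgt it.
rewrite Nt /=; case: t Nt tmin => [|t] Nt tmin; first lia.
have zt : (z t < N)%N by rewrite ltnNge; apply/negP => /tmin; rewrite ltnn.
case wE: w; first by have := regular_up t wE rz; lia.
by have := regular_jump t rz; lia.
Qed.

(** Each walk has one direction in which it moves by single steps. The (2,1) walk must pass through
    [k] at every upcrossing, so a return to [[0, k]] causes a second visit; the (1,2) walk must hit
    [k] when it comes down. *)
Lemma regular_cutpoint_stays k o t : (2 <= k)%N -> regular (Z ^~ o) ->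
  cutpoint w Z k o -> (forall i, (i < t)%N -> (Z i o < k.+1)%N) ->
  (k < Z t o)%N -> forall s, (t <= s)%N -> (k < Z s o)%N.
Proof.
move=> k2 rz cut bt kt; have [z0 _ ez] := rz.
rewrite /cutpoint in cut; case wE: w cut => cut.
- case: cut => u [_ uniq] s ts; rewrite ltnNge; apply/negP => sk.
  have prev r : (0 < r)%N -> (k < Z r o)%N -> (Z r.-1 o <= k)%N -> Z r.-1 o = k.
    by case: r => // r _ /=; have := regular_up r wE rz; lia.
  have t0 : (0 < t)%N by case: t kt {bt ts} => //; lia.
  have e1 : Z t.-1 o = k by apply: prev => //; rewrite -ltnS; apply: bt; lia.
  (* The path is unbounded after [s], so it climbs above [k] again; the first such time gives a
     visit to [k] distinct from the one before [t]. *)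
  have ex : exists r, (s <= r)%N && (k < Z r o)%N.
    by have [r sr kr] := ez k.+1 s; exists r; rewrite sr.
  case: (ex_minnP ex) => r /andP[sr kr] rmin.
  have sr' : (s < r)%N.
    by rewrite ltn_neqAle sr andbT; apply/eqP => srE; rewrite srE in sk; lia.
  have e2 : Z r.-1 o = k.
    apply: prev => //; first lia.
    rewrite leqNgt; apply/negP => h; have := rmin r.-1; rewrite h andbT; lia.
  have := uniq _ e1; rewrite -(uniq _ e2).
  have : t != s by apply/eqP => e; rewrite -e in sk; lia.
  lia.
- elim=> [|s IH] ts; first by move: ts kt; rewrite leqn0 => /eqP ->.
  have [ts'|ts'] := ltnP s t; first by have <- : t = s.+1 by lia.
  have := regular_down s wE rz; have := IH ts'; have := cut s.+1; lia.
Qed.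

Lemma measurable_cutpoint k : measurable [set o | cutpoint w Z k o].
Proof.
have mt := measurable_at_time Zwalk; rewrite /cutpoint; case: w.
- rewrite (_ : mkset _ = \bigcup_t (at_time Z t [set k] `&`
      \bigcap_(s in [set s | s <> t]) at_time Z s (~` [set k]))); last first.
    apply/seteqP; split => [ o [t [tk uniq]]| o [t _ [tk uniq]]].
    + exists t => //; split => // s st sk; apply: st; exact: uniq.
    + exists t; split => // s sk; apply: contrapT => st; exact: (uniq s st).
  apply: bigcupT_measurable => t; apply: measurableI => //.
  by apply: bigcap_measurable => [|s _] //; exists t.+1 => /=; lia.
- rewrite (_ : mkset _ = \bigcap_t at_time Z t (~` [set k])); last first.
    by apply/seteqP; split => [ o h t _| o h t]; [exact: h|exact: (h t I)].
  by apply: bigcap_measurable => // t _; exact: mt.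
Qed.

(** The first passage above [k] lands on [k + 1] or [k + 2], after which a cutpoint keeps the path
    above [k], in particular for [m] steps. *)
Lemma cutpoint_prob_le k v m : (2 <= k)%N -> 0 <= v ->
  (forall x, (k < x <= k.+2)%N -> stay_prob [pred y | k < y]%N m x <= v) ->
  (P [set o | cutpoint w Z k o] <= v%:E)%E.
Proof.
move=> k2 v0 hv; have mE := measurable_cutpoint k.
apply: (measure_entry_le Zwalk p_ge0 exits (N := k.+1)
  (X := [pred x | k < x <= k.+2]%N)) => //.
- by move=> x /andP[].
- move=> z rz; have [//|t [h1 h2]] := @regular_entry z k.+1 _ rz.
  by exists t; split => //=; move: h2; case: w; lia.
move=> t x /= Xx.
apply: (@le_trans _ _ (P (entry Z k.+1 t x `&` stays Z t [pred y | k < y]%N m))).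
  apply: (le_measure_negligible _ _ (negligible_irregular Zwalk p_ge0 exits)).
  - by apply: measurableI => //; exact: (measurable_entry Zwalk).
  - apply: measurableI; first exact: (measurable_entry Zwalk).
    exact: (measurable_stays Zwalk).
  move=> o [cut [bt zt]]; have [rz|] := pselect (regular (Z ^~ o)); last by right.
  left; split => // i _ /=.
  apply: (regular_cutpoint_stays k2 rz cut bt) => //; last exact: leq_addr.
  by move: zt; rewrite /at_time /= => ->; case/andP: Xx.
rewrite (past_stays Zwalk p_ge0 _ _ _ (past_below Z k.+1 t)) muleC.
by apply: lee_wpmul2r; rewrite ?measure_ge0 // lee_fin hv.
Qed.

(** Continuity from above along the decreasing events of staying in [G] for [m] steps, after the
    prescribed bridge [l]. *)
Lemma past_follows_stays_forever t H x l (G : pred nat) v :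
  past Z t H -> 0 <= v -> (forall m, v <= stay_prob G m (last x l)) ->
  ((path_weight w q p1 p2 x l * v)%:E * P (H `&` at_time Z t [set x]) <=
   P (H `&` follows Z t (x :: l) `&` \bigcap_m stays Z (t + size l) G m))%E.
Proof.
move=> pH v0 hv; set F := H `&` follows Z t (x :: l).
have mF : measurable F.
  apply: measurableI; first exact: (measurable_past Zwalk pH).
  exact: (measurable_follows Zwalk).
pose A m := F `&` stays Z (t + size l) G m.
have mA m : measurable (A m).
  by apply: measurableI => //; exact: (measurable_stays Zwalk).
have AE : F `&` \bigcap_m stays Z (t + size l) G m = \bigcap_m A m.
  by rewrite bigcapIr //; exists 0%N.
rewrite AE; have cv : (P \o A) @ \oo --> P (\bigcap_m A m).
  apply: nonincreasing_cvg_mu => //.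
  - by apply: le_lt_trans (probability_le1 P (mA 0%N)) _; rewrite ltry.
  - exact: bigcap_measurable.
  - move=> i j ij; apply/subsetPset => o [Fo so]; split => // r ri.
    by apply: so; apply: leq_trans ri ij.
rewrite -(cvg_lim _ cv) //; apply: lime_ge; first by apply/cvg_ex; eexists; exact: cv.
apply: nearW => m; rewrite /= /A /F (past_follows_stays Zwalk p_ge0 _ _ _ _ pH) muleC.
apply: lee_wpmul2l; first exact: measure_ge0.
rewrite lee_fin ler_wpM2l //.
by elim: l x {hv F mF A mA AE cv} => //= y l IH x; rewrite mulr_ge0.
Qed.

(** A bridge of at most three steps, each of probability at least [c], leads from the first passage
    to [k + 1] with the right number of visits to [k]; from there the walk escapes with probability
    at least [v]. The condition [5 <= k] keeps the bridge on sites at least 2. *)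
Lemma cutpoint_prob_ge k (c v : R) : (5 <= k)%N -> 0 <= c -> 0 <= v ->
  (forall j, (k <= j.+3)%N -> c <= q j /\ c <= p2 j) ->
  (forall m, v <= stay_prob [pred y | k < y]%N m k.+1) ->
  ((c ^+ 3 * v)%:E <= P [set o | cutpoint w Z k o])%E.
Proof.
move=> k5 c0 v0 hc hv; have mE := measurable_cutpoint k.
have c1 : c <= 1.
  have [|h _] := hc k; first by lia.
  have [|qk0 [p1k0 [p2k0 pk1]]] := @prob_params k; first by lia.
  lra.
(* The (2,1) walk enters [[k, oo)] at [k], its single visit. For the (1,2) walk the passage is taken
   at level [k - 2], where it lands on [k - 2] or [k - 1] and thus still avoids [k]. *)
pose N := if w is W21 then k else k.-2.
pose X : pred nat := [pred x | N <= x <= N + (if w is W21 then 0 else 1)]%N.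
(* From [k - 1] the jump by two skips [k]. From [k - 2] that jump would hit [k], and the step up by
   one may have probability 0, whence the detour through [k - 3]. *)
pose l x := if x == k.-2 then [:: (k - 3)%N; k.-1; k.+1] else [:: k.+1].
have lastl x : last x (l x) = k.+1 by rewrite /l; case: ifP.
have N3 : (3 <= N)%N by rewrite /N; case: w; lia.
have cvc : 0 <= c ^+ 3 * v by rewrite mulr_ge0 ?exprn_ge0.
apply: (measure_entry_ge Zwalk p_ge0 exits (N := N) (X := X)) => //.
- by move=> x /andP[].
- move=> z rz; have [//|t [h1 h2]] := @regular_entry z N _ rz.
  by exists t.
move=> t x Xx.
have wt : c ^+ 3 <= path_weight w q p1 p2 x (l x).
  have c3 : c ^+ 3 <= c by rewrite exprS ler_piMr // exprn_ile1.
  move: Xx; rewrite /X /N /= /l; case: w => /= Xx.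
  - have -> : x = k by lia.
    rewrite ifF /=; last lia.
    rewrite mulr1; apply: (le_trans c3); apply: le_trans (hc k _).1 _; first lia.
    rewrite /trans (_ : (k == 0)%N = false); last lia.
    by rewrite (_ : (k == 1)%N = false) ?eqxx //; lia.
  - have qj j y : (k <= j.+3)%N -> y = j.-1 -> c <= trans W12 q p1 p2 j y.
      move=> kj ->; apply: le_trans (hc j kj).1 _; rewrite /trans.
      rewrite (_ : (j == 0)%N = false); last lia.
      by rewrite (_ : (j == 1)%N = false) ?eqxx //; lia.
    have pj j y : (k <= j.+3)%N -> y = j.+2 -> c <= trans W12 q p1 p2 j y.
      move=> kj ->; apply: le_trans (hc j kj).2 _; rewrite /trans.
      rewrite (_ : (j.+2 == j.-1) = false); last lia.
      rewrite (_ : (j.+2 == j.+1) = false); last lia.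
      rewrite (_ : (j == 0)%N = false); last lia.
      rewrite (_ : (j == 1)%N = false); last lia.
      by rewrite eqxx.
    case: ifP => [/eqP xE|xN].
    + rewrite /path_weight mulr1 !exprS expr0 mulr1.
      apply: ler_pM => //; first by rewrite mulr_ge0.
        by apply: qj; lia.
      by apply: ler_pM => //; apply: pj; lia.
    + rewrite /path_weight mulr1; apply: (le_trans c3); apply: pj; lia.
apply: (@le_trans _ _ ((path_weight w q p1 p2 x (l x) * v)%:E * P (entry Z N t x))%E).
  by apply: lee_wpmul2r; rewrite ?measure_ge0 // lee_fin ler_wpM2r.
have hv' m : v <= stay_prob [pred y | k < y]%N m (last x (l x)) by rewrite lastl.
apply: le_trans (past_follows_stays_forever (past_below Z N t) v0 hv') _.
have mF : measurable (below Z N t `&` follows Z t (x :: l x)).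
  apply: measurableI; first exact: (measurable_past Zwalk (past_below Z N t)).
  exact: (measurable_follows Zwalk).
apply: le_measure; rewrite ?inE.
- apply: measurableI => //; apply: bigcap_measurable => // m _.
  exact: (measurable_stays Zwalk).
- by apply: measurableI => //; exact: (measurable_entry Zwalk).
move=> o [[bt ft] st]; have zx : Z t o = x.
  by have := ft 0%N isT; rewrite addn0.
have st' s : (t + size (l x) <= s)%N -> (k < Z s o)%N.
  by move=> h; have := st s I (s - (t + size (l x)))%N (leq_subr _ _); rewrite subnKC.
split; last by split.
have bt' i : (i < t)%N -> (Z i o < N)%N by exact: bt.
move: Xx bt' ft st'; rewrite /X /= /N /l /cutpoint; case: w => /= Xx bt' ft st'.
- have xk : x = k by lia.
  move: ft st'; rewrite xk ifF; last lia.
  move=> ft st'; exists t; split => [|s sk]; first by rewrite zx.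
  have [st1|ts|//] := ltngtP s t; first by have := bt' s st1; lia.
  have : (k < Z s o)%N by apply: st' => /=; lia.
  lia.
- move=> s sk; have [st1|ts] := ltnP s t; first by have := bt' s st1; lia.
  case: ifP ft st' => xE ft st'.
  + have [h|h] := leqP (t + 3)%N s; first by have := st' s h; lia.
    have : (s - t < 3)%N by lia.
    move: ft => /(_ (s - t)%N); rewrite subnKC // sk /=.
    case: (s - t)%N => [|[|[|//]]] /= h1 h2; have := h1 isT; lia.
  + have [h|h] := leqP (t + 1)%N s; first by have := st' s h; lia.
    have : (s - t < 1)%N by lia.
    move: ft => /(_ (s - t)%N); rewrite subnKC // sk /=.
    case: (s - t)%N => [|//] /= h1 h2; have := h1 isT; lia.
Qed.

End Cutpoints.

(** * Slow variation of (log log n) ^ beta and sums of 1 / g *)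

HB.lock Definition llog {R : realType} (beta : R) (n : nat) : R :=
  ln (ln n%:R) `^ beta.

Section Gauge.
Context {R : realType} (beta : R).
Hypothesis beta_ge0 : 0 <= beta.
Hypothesis beta_lt1 : beta < 1.

Local Notation llog := (llog beta).
Definition gauge (n : nat) : R := n%:R * llog n.

Lemma near_ln_ge (M : R) : exists N, forall n, (N <= n)%N -> M <= ln (n%:R : R).
Proof.
have [N _ HN] := nbhs_infty_ger (expR M); exists N => n /HN /= h.
rewrite -[leLHS]expRK ler_ln ?posrE ?expR_gt0 //.
by apply: lt_le_trans h; exact: expR_gt0.
Qed.

Lemma lnB_le (x y : R) : 0 < x -> 0 < y -> ln y - ln x <= (y - x) / x.
Proof.
move=> x0 y0; rewrite -ln_div ?posrE //.
have -> : y / x = 1 + (y - x) / x by rewrite mulrBl divff ?gt_eqF //; lra.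
apply: le_ln1Dx; rewrite mulrBl divff ?gt_eqF // ltrBrDr addNr.
exact: divr_gt0.
Qed.

Lemma lnS_le (n : nat) : (0 < n)%N -> ln (n.+1%:R : R) - ln n%:R <= n%:R^-1.
Proof.
move=> n0; apply: le_trans (lnB_le _ _) _; rewrite ?ltr0n //.
by rewrite -natrB // subSnn div1r.
Qed.

Lemma lnS_ge (n : nat) : (0 < n)%N -> n.+1%:R^-1 <= ln (n.+1%:R : R) - ln n%:R.
Proof.
move=> n0; have : ln (n%:R : R) - ln n.+1%:R <= (n%:R - n.+1%:R) / n.+1%:R.
  by apply: lnB_le; rewrite ltr0n.
have -> : n%:R - n.+1%:R = -1 :> R by rewrite -[n.+1%:R]natr1 opprD addrA subrr add0r.
by rewrite mulN1r lerNr opprB.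
Qed.

Lemma powR_increment (u v : R) : 0 < u -> u <= v ->
  v `^ beta - u `^ beta <= u `^ beta * ((v - u) / u).
Proof.
move=> u0 uv; have vE : v = u * (v / u) by rewrite mulrCA divff ?mulr1 ?gt_eqF.
have r1 : 1 <= v / u by rewrite ler_pdivlMr // mul1r.
have r0 : 0 <= v / u by lra.
rewrite {1}vE powRM //; last exact: ltW.
have -> : (v - u) / u = v / u - 1 by rewrite mulrBl divff ?gt_eqF.
rewrite mulrBr mulr1 lerB // ler_wpM2l ?powR_ge0 //.
rewrite -[leRHS]powRr1 //; apply: ler_powR => //; exact: ltW.
Qed.

(** The last bound is a discrete form of the fact that the logarithmic derivative of [llog] with
    respect to log n is beta / (log n log log n). Taking [ln n >= expR 2] makes [ln (ln n) >= 2],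
    the source of the factor 1/2. *)
Lemma gauge_growth : exists N, forall n, (N <= n)%N ->
  [/\ (16 <= n)%N, 1 <= ln n%:R :> R, 1 <= llog n, llog n <= llog n.+1 &
      ln n%:R * (llog n.+1 - llog n) <=
        llog n / 2 * (ln n.+1%:R - ln n%:R)].
Proof.
have [N HN] := near_ln_ge (expR 2).
exists (maxn N 16) => n; rewrite geq_max => /andP[/HN h n16].
have n0 : (0 < n)%N by lia.
have e2 : (1 : R) <= expR 2 by rewrite -expR0 ler_expR.
have l0 : 0 < ln (n%:R : R) by apply: lt_le_trans h; exact: expR_gt0.
have l1 : 1 <= ln (n%:R : R) by apply: le_trans h.
have lS : ln (n%:R : R) <= ln n.+1%:R.
  by rewrite ler_ln ?posrE ?ltr0n // ler_nat.
have lS0 : 0 < ln (n.+1%:R : R) by exact: lt_le_trans lS.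
have u2 : 2 <= ln (ln (n%:R : R)).
  by rewrite -[leLHS]expRK ler_ln ?posrE ?expR_gt0.
have uS : ln (ln (n%:R : R)) <= ln (ln n.+1%:R) by rewrite ler_ln ?posrE.
have L1 : 1 <= llog n.
  rewrite llog.unlock; apply: (@le_trans _ _ (ln (ln n%:R) `^ 0)).
    by rewrite powRr0.
  by apply: ler_powR => //; lra.
have LS : llog n <= llog n.+1.
  by rewrite llog.unlock; apply: ge0_ler_powR => //; rewrite nnegrE; lra.
split => //.
have h1 := @powR_increment (ln (ln n%:R)) (ln (ln n.+1%:R)) _ uS.
have h2 := @lnB_le (ln n%:R) (ln n.+1%:R) l0 lS0.
have h3 : llog n.+1 - llog n <= llog n * ((ln (ln n.+1%:R) - ln (ln n%:R)) / 2).
  rewrite llog.unlock.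
  apply: (le_trans (h1 _)); first by lra.
  rewrite ler_wpM2l //; first exact: powR_ge0.
  rewrite ler_wpM2l ?subr_ge0 // lef_pV2 ?posrE //; lra.
apply: (@le_trans _ _ (ln n%:R * (llog n *
   ((ln n.+1%:R - ln n%:R) / ln n%:R / 2)))).
  apply: ler_wpM2l; first exact: ltW.
  apply: (le_trans h3); apply: ler_wpM2l; first lra.
  by rewrite ler_wpM2r // invr_ge0.
rewrite le_eqVlt; apply/orP; left; apply/eqP; field; exact: lt0r_neq0.
Qed.

Lemma llog_small (e : R) : 0 < e -> exists N, forall n, (N <= n)%N ->
  llog n <= e * ln n%:R.
Proof.
move=> e0; have [N0 HN0] := gauge_growth.
(* With [y = ln n], the bound [ln y <= 2 sqrt y] reduces the claim to [2 / e <= sqrt y]; the summand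
   [expR 2] ensures [ln y >= 1], so that the power [beta] is at most the first power. *)
have [N HN] := near_ln_ge (expR 2 + (2 / e) ^+ 2).
exists (maxn N N0) => n; rewrite geq_max => /andP[/HN h /HN0 [_ l1 _ _ _]].
have l0 : 0 < ln (n%:R : R) by lra.
have sq0 : 0 <= (2 / e) ^+ 2 by exact: sqr_ge0.
have u1 : 1 <= ln (ln (n%:R : R)).
  apply: (@le_trans _ _ 2); first lra.
  by rewrite -[leLHS]expRK ler_ln ?posrE ?expR_gt0 //; lra.
apply: (@le_trans _ _ (ln (ln n%:R))).
  rewrite llog.unlock -[leRHS]powRr1; last lra.
  by apply: ler_powR => //; exact: ltW.
set y := ln n%:R in l0 h *.
have s0 : 0 < Num.sqrt y by rewrite sqrtr_gt0.
have yE : y = Num.sqrt y ^+ 2 by rewrite sqr_sqrtr // ltW.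
have lny : ln y <= 2 * Num.sqrt y.
  have := ln_sublinear s0; have -> : ln y = ln (Num.sqrt y) + ln (Num.sqrt y).
    by rewrite [in LHS]yE lnXn ?mulr2n.
  lra.
apply: (le_trans lny); rewrite {2}yE expr2 mulrA ler_pM2r //.
have : 2 / e <= Num.sqrt y.
  rewrite -[leLHS]ger0_norm ?divr_ge0 ?(ltW e0) // -sqrtr_sqr ler_wsqrtr //.
  by apply: le_trans h; rewrite lerDr expR_ge0.
by rewrite ler_pdivrMr // mulrC.
Qed.

Lemma llog_homo : exists N, forall i j, (N <= i)%N -> (i <= j)%N -> llog i <= llog j.
Proof.
have [N HN] := gauge_growth; exists N => i j Ni.
move=> /subnKC <-; elim: (j - i)%N => [|r IH]; first by rewrite addn0.
have [|_ _ _ h _] := HN (i + r)%N; first by rewrite (leq_trans Ni) // leq_addr.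
by apply: (le_trans IH); rewrite addnS.
Qed.

Lemma sum_gauge_ge : exists N, forall m n, (N <= m)%N -> (m <= n)%N ->
  (ln n%:R - ln m%:R) / llog n <= \sum_(m <= j < n) (gauge j)^-1.
Proof.
have [N1 HN] := gauge_growth; have [N2 mono] := llog_homo.
exists (N1 + N2)%N => m n Nm mn.
rewrite -(telescope_sumr (fun j => ln (j%:R : R)) mn) mulr_suml.
apply: ler_sum_nat => j /andP[mj jn].
have [Nj1 Nj2] : (N1 <= j)%N /\ (N2 <= j)%N by clear - Nm mj; lia.
have [j16 _ L1 _ _] := HN j Nj1.
have Ljn := mono j n Nj2 (ltnW jn).
have j0 : (0 < j)%N := leq_trans (isT : 0 < 16)%N j16.
rewrite /gauge invfM; apply: ler_pM.
- by rewrite subr_ge0 ler_ln ?posrE ?ltr0n // ler_nat.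
- by rewrite invr_ge0; lra.
- exact: lnS_le.
- by rewrite lef_pV2 ?posrE //; lra.
Qed.

(** Each term is at most an increment of [2 ln / llog]: by [gauge_growth] the growth of [llog] costs
    at most half of the growth of [ln], and the factor 2 makes up for it. *)
Lemma sum_gauge_le : exists N, forall m n, (N <= m)%N -> (m <= n)%N ->
  \sum_(m <= j < n) (gauge j.+1)^-1 <= 2 * (ln n%:R / llog n).
Proof.
have [N HN] := gauge_growth; exists N => m n Nm mn.
pose G j : R := 2 * (ln j%:R / llog j).
have G0 : 0 <= G m.
  have [_ l1 L1 _ _] := HN m Nm.
  by rewrite /G !mulr_ge0 ?invr_ge0 //; lra.
apply: (@le_trans _ _ (G n - G m)); last by rewrite lerBlDr lerDl.
rewrite -(telescope_sumr G mn); apply: ler_sum_nat => j /andP[mj _].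
have [j16 l1 L1 LS h] := HN j (leq_trans Nm mj).
have j0 : (0 < j)%N := leq_trans (isT : 0 < 16)%N j16.
have dl := @lnS_ge j j0.
rewrite /G /gauge invfM; move: l1 L1 LS h dl.
move: (ln j%:R) (ln j.+1%:R) (llog j) (llog j.+1) => l l' L L' l1 L1 LS h dl.
have L0 : 0 < L by lra.
have L'0 : 0 < L' by lra.
apply: (@le_trans _ _ ((l' - l) * L'^-1)).
  by rewrite ler_wpM2r // invr_ge0 ltW.
have -> : 2 * (l' / L') - 2 * (l / L) =
    2 * ((l' - l) * L - l * (L' - L)) / L * L'^-1.
  by field; rewrite !lt0r_neq0.
by rewrite ler_wpM2r ?invr_ge0 ?(ltW L'0) // ler_pdivlMr //; lra.
Qed.

Lemma sum_gauge_diverges : exists N, forall m B, (N <= m)%N ->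
  exists2 n, (m <= n)%N & B <= \sum_(m <= j < n) (gauge j)^-1.
Proof.
have [N1 H1] := sum_gauge_ge; have [N2 H2] := gauge_growth.
exists (N1 + N2)%N => m B Nm.
have [Nm1 Nm2] : (N1 <= m)%N /\ (N2 <= m)%N by clear - Nm; lia.
pose B' : R := `|B| + 1.
have BB' : B <= B' by rewrite /B' (le_trans (ler_norm B)) // lerDl.
have B'0 : 0 < B' by rewrite /B' ltr_wpDl.
have e0 : 0 < (2 * B')^-1 by rewrite invr_gt0 mulr_gt0.
have [N3 H3] := llog_small e0.
(* This gives [ln n - ln m >= ln n / 2]; the other half of the constant [2 * B'] is then what
   [llog_small] has to beat. *)
have [N4 H4] := near_ln_ge (2 * ln m%:R).
pose n := (m + N3 + N4)%N.
have [mn nN3 nN4] : [/\ (m <= n)%N, (N3 <= n)%N & (N4 <= n)%N].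
  by rewrite /n; split; lia.
exists n => //; apply: (le_trans BB'); apply: le_trans (H1 m n Nm1 mn).
have [_ _ L1 _ _] := H2 n (leq_trans Nm2 mn).
have L0 : 0 < llog n by lra.
rewrite ler_pdivlMr //; have h4 := H4 n nN4.
have : B' * llog n <= B' * ((2 * B')^-1 * ln n%:R).
  by apply: ler_wpM2l; [exact: ltW|exact: H3].
have -> : B' * ((2 * B')^-1 * ln n%:R) = 2^-1 * ln n%:R.
  by field; exact: lt0r_neq0.
lra.
Qed.

End Gauge.

(** * The sequences d with prescribed quotients *)

Section Envelope.
Context {R : realType} (beta : R).
Hypothesis beta_ge0 : 0 <= beta.
Hypothesis beta_lt1 : beta < 1.
Local Notation llog := (llog beta).
Local Notation gauge := (gauge beta).

Definition slope (n : nat) : R := n%:R^-1 + (gauge n)^-1.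

Lemma llog_increment : exists N, forall n, (N <= n)%N ->
  [/\ (16 <= n)%N, 1 <= llog n, llog n <= llog n.+1 &
      n%:R * (llog n.+1 - llog n) * ln n%:R <= llog n / 2 /\ 1 <= ln n%:R :> R].
Proof.
have [N HN] := gauge_growth beta_ge0 beta_lt1; exists N => n /HN [n16 l1 L1 LS h].
split => //; split => //.
have n0 : (0 : R) < n%:R by rewrite ltr0n (leq_trans _ n16).
have dl := @lnS_le R n (leq_trans (isT : 0 < 16)%N n16).
have h2 : ln n%:R * (llog n.+1 - llog n) <= llog n / 2 * n%:R^-1.
  by apply: (le_trans h); rewrite ler_wpM2l //; lra.
rewrite ler_pdivlMr // in h2.
by apply: le_trans h2; rewrite le_eqVlt; apply/orP; left; apply/eqP; ring.
Qed.

Lemma slope_increment : exists N, forall n, (N <= n)%N ->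
  [/\ (16 <= n)%N, 0 < slope n, slope n <= 2 / n%:R, slope n.+1 <= slope n &
      slope n - slope n.+1 <= 3 / n%:R ^+ 2].
Proof.
have [N HN] := llog_increment; exists N => n /HN [n16 L1 LS [hl l1]].
have n0 : (0 : R) < n%:R by rewrite ltr0n (leq_trans _ n16).
rewrite /slope /gauge -[n.+1%:R]natr1.
set x := n%:R in n0 hl *; set M := llog n in L1 LS hl *.
set M' := llog n.+1 in LS hl *.
have xM : x * (M' - M) <= M / 2.
  apply: le_trans hl; rewrite ler_peMr // mulr_ge0 ?subr_ge0 //; exact: ltW.
have M0 : 0 < M by lra.
have M0' : 0 < M' by lra.
have xV : 0 < x^-1 by rewrite invr_gt0.
have x1 : 0 < x + 1 by lra.
have xMV : (x * M)^-1 <= x^-1.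
  by rewrite lef_pV2 ?posrE ?mulr_gt0 // ler_peMr // ltW.
split => //.
- by rewrite addr_gt0 // invr_gt0 mulr_gt0.
- by lra.
- apply: lerD; rewrite lef_pV2 ?posrE ?mulr_gt0 //; first lra.
  by apply: ler_pM => //; lra.
- have -> : x^-1 + (x * M)^-1 - ((x + 1)^-1 + ((x + 1) * M')^-1) =
      (1 + ((x + 1) * M' - x * M) / (M * M')) / (x * (x + 1)).
    by field; rewrite !lt0r_neq0.
  rewrite ler_pdivrMr ?mulr_gt0 //.
  apply: (@le_trans _ _ 3).
    have : ((x + 1) * M' - x * M) / (M * M') <= 2.
      rewrite ler_pdivrMr ?mulr_gt0 //.
      have hM : M <= M * M' by rewrite ler_peMr //; lra.
      have hM' : M' <= M * M' by rewrite ler_peMl //; lra.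
      clear - xM hM hM' M0; lra.
    by move=> t; clear - t; lra.
  rewrite mulrAC ler_pdivlMr ?exprn_gt0 // expr2 ler_wpM2l //.
  by rewrite ler_pM2l // lerDl.
Qed.

Definition envelope_ratio (k : R) (j : nat) : R :=
  1 - slope j + k / j%:R ^+ 2.

(** One step involves quotients at [n], [n + 1], [n + 2]. Two slope increments cost [6 / n ^ 2], and
    [j <= 2 n] gives [1 / n ^ 2 <= 4 / j ^ 2]; hence the constant [4 (C + 6)]. *)
Lemma envelope_ratio_bounds (C : R) : 0 <= C -> exists N, forall n, (N <= n)%N ->
  forall s, `|s - (1 - slope n)| <= C / n%:R ^+ 2 ->
  forall j, (n <= j <= n.+2)%N ->
  envelope_ratio (- (4 * C + 24)) j <= s <= envelope_ratio (4 * C + 24) j.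
Proof.
move=> C0; have [N HN] := slope_increment; exists N => n Nn s hs j /andP[nj jn].
have jE : j = n \/ j = n.+1 \/ j = n.+2 by clear - nj jn; lia.
have [n16 _ _ s1 s2] := HN n Nn; have [_ _ _ s3 s4] := HN n.+1 (leqW Nn).
have n0 : (0 : R) < n%:R by rewrite ltr0n (leq_trans _ n16).
have j0 : (0 : R) < j%:R by rewrite ltr0n (leq_trans _ nj) // (leq_trans _ n16).
have iS : 3 / n.+1%:R ^+ 2 <= 3 / n%:R ^+ 2 :> R.
  have nS : (n%:R : R) <= n.+1%:R by rewrite ler_nat.
  have sq : (n%:R : R) ^+ 2 <= n.+1%:R ^+ 2 by rewrite ler_pXn2r ?nnegrE //; lra.
  by rewrite ler_wpM2l // lef_pV2 ?posrE ?exprn_gt0 //; lra.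
have s4' := le_trans s4 iS.
have hj : slope n - 6 / n%:R ^+ 2 <= slope j <= slope n.
  have n2 : (0 : R) <= (n%:R ^+ 2)^-1 by rewrite invr_ge0 exprn_ge0 // ltW.
  have [->|[->|->]] := jE.
  - by apply/andP; split; lra.
  - by apply/andP; split; lra.
  - by apply/andP; split; lra.
have ij : (n%:R ^+ 2)^-1 <= 4 * (j%:R ^+ 2)^-1 :> R.
  rewrite ler_pdivlMr ?exprn_gt0 // mulrC ler_pdivrMr ?exprn_gt0 //.
  have : (j%:R : R) <= 2 * n%:R by rewrite -natrM ler_nat; clear - jn n16; lia.
  by move=> h; clear - h n0 j0; move: h n0 j0; move: (n%:R : R) (j%:R : R) => x y *; nra.
have ij1 : (4 * C + 24) * (n%:R ^+ 2)^-1 <= 4 * ((4 * C + 24) * (j%:R ^+ 2)^-1).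
  by rewrite mulrCA ler_wpM2l //; lra.
have n2 : (0 : R) <= (n%:R ^+ 2)^-1 by rewrite invr_ge0 exprn_ge0 // ltW.
have Cn : 0 <= C * (n%:R ^+ 2)^-1 by rewrite mulr_ge0.
move: hs hj; rewrite ler_norml /envelope_ratio mulNr => /andP[h1 h2] /andP[h3 h4].
by apply/andP; split; lra.
Qed.

Lemma envelope_exists (k : R) : exists N (d : nat -> R), forall n, (N <= n)%N ->
  [/\ 0 < d n, d n.+1 = envelope_ratio k n.+1 * d n, d n.+1 <= d n,
      d n / 2 <= gauge n * d n - gauge n.+1 * d n.+1 &
      gauge n * d n - gauge n.+1 * d n.+1 <= 2 * d n].
Proof.
have [N1 H1] := slope_increment; have [N2 H2] := llog_increment.
pose K : R := `|k| + 1.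
have kK : `|k| <= K by rewrite /K lerDl.
have K0 : 0 < K by rewrite /K ltr_wpDl.
have e0 : 0 < (4 * K)^-1 by rewrite invr_gt0 mulr_gt0.
have [N3 H3] := llog_small beta_ge0 beta_lt1 e0.
have h2 : 0 < 2^-1 :> R by [].
have [N4 H4] := llog_small beta_ge0 beta_lt1 h2.
have [N5 _ H5] := nbhs_infty_ger (K : R).
pose N := (N1 + N2 + N3 + N4 + N5)%N.
have le_N j : (N <= j)%N ->
    [/\ (N1 <= j)%N, (N2 <= j)%N, (N3 <= j.+1)%N, (N4 <= j)%N & (N5 <= j)%N].
  by rewrite /N => ?; split; lia.
have ratio_in j : (N <= j)%N -> 0 < envelope_ratio k j <= 1.
  move=> /le_N[Nj1 Nj2 _ _ Nj5]; have [j16 s0 s2 _ _] := H1 j Nj1.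
  have Kj : K <= j%:R by exact: H5.
  have [_ M1 _ _] := H2 j Nj2.
  have j0 : (0 : R) < j%:R by rewrite ltr0n (leq_trans _ j16).
  have j16' : (16 : R) <= j%:R by rewrite ler_nat.
  have kj : `|k / j%:R ^+ 2| <= j%:R^-1.
    rewrite normrM normfV (@ger0_norm _ (j%:R ^+ 2)) ?exprn_ge0 ?(ltW j0) //.
    rewrite ler_pdivrMr ?exprn_gt0 // expr2 mulKf ?gt_eqF //; exact: le_trans kK Kj.
  have s1 : j%:R^-1 <= slope j.
    by rewrite /slope lerDl invr_ge0 mulr_ge0 ?(ltW j0) //; lra.
  have jV : j%:R^-1 <= 16^-1 :> R by rewrite lef_pV2 ?posrE.
  move: kj; rewrite ler_norml => /andP[k1 k2].
  by rewrite /envelope_ratio; apply/andP; split; lra.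
(* The factors 1 are an initialisation: the ratio is known to be positive only from [N] on. *)
pose d n := \prod_(i < n.+1) (if (i <= N)%N then 1 else envelope_ratio k i).
exists N, d => n Nn.
have dS : d n.+1 = envelope_ratio k n.+1 * d n.
  rewrite /d big_ord_recr /= mulrC ifF //; apply/negbTE; rewrite -ltnNge ltnS //.
have d0 : 0 < d n.
  apply: prodr_gt0 => i _; case: ifPn => //; rewrite -ltnNge => /ltnW /ratio_in.
  by case/andP.
have [_ Nn2 Nn3 Nn4 _] := le_N n Nn.
have /andP[r0 r1] := ratio_in n.+1 (leqW Nn).
have [n16 M1 MS [hl l1]] := H2 n Nn2.
have n0 : (0 : R) < n%:R by rewrite ltr0n (leq_trans _ n16).
have h3 := H3 n.+1 Nn3.
have h4 := H4 n Nn4.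
have ln_le : ln (n.+1%:R : R) <= n.+1%:R by apply: ltW; rewrite ln_sublinear ?ltr0n.
have S0 : (0 : R) < n.+1%:R by rewrite ltr0n.
have M0' : 0 < llog n.+1 by lra.
(* An exact identity. Both correction terms are shown to be at most 1/4 in absolute value, so the
   factor of [d n] lies between 1/2 and 3/2. *)
have eqn : gauge n * d n - gauge n.+1 * d n.+1 =
    (1 - n%:R * (llog n.+1 - llog n) - k * llog n.+1 / n.+1%:R) * d n.
  rewrite dS mulrA -mulrBl; congr (_ * _).
  rewrite /envelope_ratio /slope /gauge -[n.+1%:R]natr1 in S0 *; field.
  by rewrite !lt0r_neq0.
have t1 : 0 <= n%:R * (llog n.+1 - llog n) <= 4^-1.
  apply/andP; split; first by rewrite mulr_ge0 ?subr_ge0 ?(ltW n0).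
  have l0 : 0 < ln n%:R :> R by exact: lt_le_trans l1.
  rewrite -(ler_pM2r l0); apply: (le_trans hl); clear - h4; lra.
have t2 : `|k * llog n.+1 / n.+1%:R| <= 4^-1.
  rewrite !normrM normfV (gtr0_norm S0) (gtr0_norm M0') ler_pdivrMr //.
  apply: (@le_trans _ _ (K * ((4 * K)^-1 * ln n.+1%:R))).
    by apply: ler_pM => //; exact: ltW.
  have -> : K * ((4 * K)^-1 * ln n.+1%:R) = 4^-1 * ln n.+1%:R.
    by field; exact: lt0r_neq0.
  by rewrite ler_wpM2l.
move: t1 t2; rewrite ler_norml => /andP[a1 a2] /andP[b1 b2].
rewrite eqn dS; split => //; first by rewrite ler_piMl // ltW.
- rewrite mulrC ler_pM2r //; clear - a1 a2 b1 b2; move: a1 a2 b1 b2.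
  set A := n%:R * _; set B := _ * _ / _; lra.
- rewrite ler_pM2r //; clear - a1 a2 b1 b2; move: a1 a2 b1 b2.
  set A := n%:R * _; set B := _ * _ / _; lra.
Qed.

End Envelope.

(** * Partial sums of d as sub- and supersolutions, and the asymptotics of their critical
    quotient *)

Section Escape.
Context {R : realType} (w : walk_kind) (q p1 p2 : nat -> R).
Hypothesis prob_params : forall k, (2 <= k)%N ->
  0 < q k /\ 0 <= p1 k /\ 0 < p2 k /\ q k + p1 k + p2 k = 1.
Local Notation stay_prob := (stay_prob w q p1 p2).
Local Notation mean_step := (mean_step w q p1 p2).

Definition ratio_limit (n : nat) : R :=
  if w is W21 then rho q p1 p2 n else (rho q p1 p2 n)^-1.

(** [rho] is the positive root of X ^ 2 = a X + b; the equation is this one multiplied by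
    [q n / rho]. *)
Lemma rho_eqn n : (2 <= n)%N ->
  0 < rho q p1 p2 n /\
  q n * rho q p1 p2 n = (p1 n + p2 n) + p2 n / rho q p1 p2 n.
Proof.
move=> n2; have [q0 [p10 [p20 _]]] := prob_params n2.
have a0 : 0 < a_seq q p1 p2 n by rewrite divr_gt0 // ltr_wpDl.
have b0 : 0 < b_seq q p2 n by rewrite divr_gt0.
have D0 : 0 <= a_seq q p1 p2 n ^+ 2 + 4 * b_seq q p2 n.
  by rewrite addr_ge0 ?sqr_ge0 // mulr_ge0 // ltW.
have r0 : 0 < rho q p1 p2 n.
  by rewrite divr_gt0 // ltr_wpDr // sqrtr_ge0.
split => //.
have r2 : rho q p1 p2 n ^+ 2 = a_seq q p1 p2 n * rho q p1 p2 n + b_seq q p2 n.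
  have := sqr_sqrtr D0; rewrite /rho; set S := Num.sqrt _ => SE.
  have -> : ((a_seq q p1 p2 n + S) / 2) ^+ 2 =
     (a_seq q p1 p2 n ^+ 2 + 2 * a_seq q p1 p2 n * S + S ^+ 2) / 4 by field.
  by rewrite SE; field.
have -> : p1 n + p2 n = q n * a_seq q p1 p2 n.
  by rewrite /a_seq mulrCA divff ?mulr1 // gt_eqF.
have -> : p2 n = q n * b_seq q p2 n.
  by rewrite /b_seq mulrCA divff ?mulr1 // gt_eqF.
apply: (mulIf (lt0r_neq0 r0)).
rewrite [RHS]mulrDl divfK ?lt0r_neq0 // -[LHS]mulrA -expr2 r2.
by clear; ring.
Qed.

Definition partial (d : nat -> R) (k n : nat) : R := \sum_(k <= j < n.+1) d j.

Lemma partialS d k n : (k <= n.+1)%N -> partial d k n.+1 = partial d k n + d n.+1.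
Proof. by move=> kn; rewrite /partial big_nat_recr. Qed.

Lemma partial0 d k n : (n < k)%N -> partial d k n = 0.
Proof. by move=> nk; rewrite /partial big_geq. Qed.

Lemma partial_ge0 d k n : (forall j, (k <= j)%N -> 0 <= d j) -> 0 <= partial d k n.
Proof.
move=> d0; rewrite /partial big_nat_cond sumr_ge0 // => j /andP[/andP[kj _] _].
exact: d0.
Qed.

Lemma partial_le d k m n : (forall j, (k <= j)%N -> 0 <= d j) -> (m <= n)%N ->
  partial d k m <= partial d k n.
Proof.
move=> d0 /subnKC <-; elim: (n - m)%N => [|i IH]; first by rewrite addn0.
rewrite addnS; have [ki|ki] := leqP k (m + i).+1.
  by rewrite partialS // (le_trans IH) // lerDl d0.
by rewrite !partial0 //; lia.
Qed.

(** For the (2,1) walk the mean increment at [x] is q d(x+1) - (p1 + p2) d(x) - p2 d(x-1), and for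
    the (1,2) walk it is (p1 + p2) d(x+1) + p2 d(x+2) - q d(x). By [rho_eqn] both vanish when the
    quotients equal [ratio_limit x], and smaller quotients make them nonpositive. *)
Lemma mean_step_super (d : nat -> R) k x : (2 <= k)%N -> (k < x)%N ->
  (forall j, (k <= j)%N -> 0 <= d j) ->
  (forall j, (x <= j.+1 <= x.+2)%N -> d j.+1 <= ratio_limit x * d j) ->
  mean_step (partial d k) x <= partial d k x.
Proof.
case: x => [|[|n]] k2 kn d0 dr; [by []|by clear - k2 kn; lia|]; rewrite mean_stepE /up_down.
have [q0 [p10 [p20 pE]]] := @prob_params n.+2 isT.
have [r0 rE] := @rho_eqn n.+2 isT.
have := dr n.+1 ltac:(lia); have := dr n.+2 ltac:(lia); have := dr n.+3 ltac:(lia).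
have p3 : partial d k n.+3 = partial d k n.+2 + d n.+3 by rewrite partialS //; lia.
have p2E : partial d k n.+2 = partial d k n.+1 + d n.+2 by rewrite partialS //; lia.
have p1E : partial d k n.+1 = partial d k n + d n.+1 by rewrite partialS //; lia.
have p4 : partial d k n.+4 = partial d k n.+3 + d n.+4 by rewrite partialS //; lia.
rewrite /ratio_limit; move: p4 p3 p2E p1E r0 rE; set r := rho _ _ _ _.
move=> p4 p3 p2E p1E r0 rE; case: w => h4 h3 h2.
- have e3 : q n.+2 * d n.+3 <= q n.+2 * r * d n.+2 by rewrite -mulrA ler_wpM2l // ltW.
  have e2 : p2 n.+2 / r * d n.+2 <= p2 n.+2 * d n.+1.
    by rewrite -mulrA ler_wpM2l ?(ltW p20) // mulrC ler_pdivrMr // mulrC.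
  rewrite rE mulrDl in e3.
  rewrite p3 p2E p1E.
  have -> : partial d k n = partial d k n * (q n.+2 + p1 n.+2 + p2 n.+2).
    by rewrite pE mulr1.
  nra.
- have e4 : p2 n.+2 * d n.+4 <= p2 n.+2 / r * d n.+3.
    by rewrite -mulrA ler_wpM2l // ltW.
  have e3 : q n.+2 * r * d n.+3 <= q n.+2 * d n.+2.
    rewrite -mulrA ler_wpM2l ?(ltW q0) // -ler_pdivlMl //.
  rewrite rE mulrDl in e3.
  rewrite p4 p3 p2E.
  have -> : partial d k n.+1 = partial d k n.+1 * (q n.+2 + p1 n.+2 + p2 n.+2).
    by rewrite pE mulr1.
  nra.
Qed.

Lemma mean_step_sub (d : nat -> R) k x : (2 <= k)%N -> (k <= x)%N ->
  (forall j, (k <= j.+1)%N -> 0 <= d j) ->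
  (forall j, (x <= j.+1 <= x.+2)%N -> ratio_limit x * d j <= d j.+1) ->
  partial d k x <= mean_step (partial d k) x.
Proof.
case: x => [|[|n]] k2 kn d0 dr; [by clear - k2 kn; lia|by clear - k2 kn; lia|].
rewrite mean_stepE /up_down.
have [q0 [p10 [p20 pE]]] := @prob_params n.+2 isT.
have [r0 rE] := @rho_eqn n.+2 isT.
have := dr n.+1 ltac:(lia); have := dr n.+2 ltac:(lia); have := dr n.+3 ltac:(lia).
have p3 : partial d k n.+3 = partial d k n.+2 + d n.+3 by rewrite partialS //; lia.
have p2E : partial d k n.+2 = partial d k n.+1 + d n.+2 by rewrite partialS //; lia.
(* Only an inequality: at [x = k] the sum is cut off at 0 below [k], and this truncation favours a
   subsolution. *)
have p1E : partial d k n.+1 <= partial d k n + d n.+1.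
  have [kn'|kn'] := leqP k n.+1; first by rewrite partialS.
  by rewrite !partial0 ?add0r ?d0 //; lia.
have p4 : partial d k n.+4 = partial d k n.+3 + d n.+4 by rewrite partialS //; lia.
rewrite /ratio_limit; move: p4 p3 p2E p1E r0 rE; set r := rho _ _ _ _.
move=> p4 p3 p2E p1E r0 rE; case: w => h4 h3 h2.
- have e3 : q n.+2 * r * d n.+2 <= q n.+2 * d n.+3 by rewrite -mulrA ler_wpM2l // ltW.
  have e2 : p2 n.+2 * d n.+1 <= p2 n.+2 / r * d n.+2.
    by rewrite -mulrA ler_wpM2l ?(ltW p20) // -ler_pdivrMl ?invr_gt0 // invrK.
  rewrite rE mulrDl in e3.
  have e1 : p2 n.+2 * partial d k n.+1 <= p2 n.+2 * (partial d k n + d n.+1).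
    by rewrite ler_wpM2l // ltW.
  rewrite p3 p2E.
  have -> : partial d k n.+1 + d n.+2 =
      (partial d k n.+1 + d n.+2) * (q n.+2 + p1 n.+2 + p2 n.+2).
    by rewrite pE mulr1.
  nra.
- have e4 : p2 n.+2 / r * d n.+3 <= p2 n.+2 * d n.+4.
    by rewrite -mulrA ler_wpM2l // ltW.
  have e3 : q n.+2 * d n.+2 <= q n.+2 * r * d n.+3.
    by rewrite -mulrA ler_wpM2l ?(ltW q0) // -ler_pdivrMl.
  rewrite rE mulrDl in e3.
  rewrite p4 p3 p2E.
  have -> : partial d k n.+1 + d n.+2 =
      (partial d k n.+1 + d n.+2) * (q n.+2 + p1 n.+2 + p2 n.+2).
    by rewrite pE mulr1.
  nra.
Qed.

Context (beta : R).
Hypothesis beta_ge0 : 0 <= beta.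
Hypothesis beta_lt1 : beta < 1.
Hypothesis rho_asymp : exists C : R, exists K : nat, forall k, (K <= k)%N ->
     `|rho q p1 p2 k -
       (if w is W21 then 1 - 3 * r_seq beta k else 1 + 3 * r_seq beta k)|
     <= C * r_seq beta k ^+ 2.
Local Notation gauge := (gauge beta).
Local Notation slope := (slope beta).

Lemma r_seqE n : (4 <= n)%N -> 3 * r_seq beta n = slope n.
Proof.
by move=> n4; rewrite /r_seq (maxn_idPl n4) mulrA divff // mul1r /slope /gauge llog.unlock.
Qed.

(** Both walks share the expansion [1 - slope n]: the (1,2) walk has [rho] near [1 + slope n], and
    inversion costs another [slope n ^+ 2], of order 1 / n ^ 2. *)
Lemma ratio_limit_asymp : exists C N, 0 <= C /\ forall n, (N <= n)%N ->
  `|ratio_limit n - (1 - slope n)| <= C / n%:R ^+ 2.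
Proof.
have [C [K HK]] := rho_asymp; have [N1 H1] := slope_increment beta_ge0 beta_lt1.
pose B : R := 2 + `|C|.
have B0 : 0 < B by rewrite /B ltr_wpDr.
have [N2 _ H2] := nbhs_infty_ger (16 * B : R).
exists (8 * B), (K + N1 + N2)%N; split; first by rewrite mulr_ge0 // ltW.
move=> n Nn; have [nK nN1 nN2] : [/\ (K <= n)%N, (N1 <= n)%N & (N2 <= n)%N].
  by clear - Nn; split; lia.
have [n16 s0 s2 _ _] := H1 n nN1.
have := HK n nK; rewrite r_seqE ?(leq_trans _ n16) //.
have [r0 _] := @rho_eqn n (leq_trans (isT : 2 <= 16)%N n16).
have n0 : (0 : R) < n%:R by rewrite ltr0n (leq_trans _ n16).
have Bn : 16 * B <= n%:R by exact: H2.
have n16' : (16 : R) <= n%:R by rewrite ler_nat.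
have nV : n%:R^-1 <= 16^-1 :> R by rewrite lef_pV2 ?posrE.
have r3 : r_seq beta n = slope n / 3.
  by rewrite -(@r_seqE n (leq_trans _ n16)) // mulrC mulKf.
have sq : slope n ^+ 2 <= 4 * (n%:R ^+ 2)^-1.
  have -> : 4 * (n%:R ^+ 2)^-1 = (2 / n%:R) ^+ 2 :> R by rewrite expr_div_n; ring.
  by rewrite ler_pXn2r ?nnegrE //; lra.
have sq0 : 0 <= slope n ^+ 2 by exact: sqr_ge0.
have nV2 : 0 < (n%:R ^+ 2)^-1 :> R by rewrite invr_gt0 exprn_gt0.
have err : C * r_seq beta n ^+ 2 <= `|C| * slope n ^+ 2.
  rewrite r3 expr_div_n; apply: (@le_trans _ _ (`|C| * (slope n ^+ 2 / 3 ^+ 2))).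
    by rewrite ler_wpM2r ?ler_norm // divr_ge0.
  rewrite ler_wpM2l // ler_pdivrMr // ler_peMr //; lra.
rewrite /ratio_limit; case: w; move=> /le_trans /(_ err) h.
- apply: (le_trans h); apply: (@le_trans _ _ (`|C| * (4 * (n%:R ^+ 2)^-1))).
    by rewrite ler_wpM2l.
  rewrite mulrA ler_wpM2r ?(ltW nV2) //.
  by rewrite /B; have := normr_ge0 C; lra.
- set s := slope n in s0 s2 sq sq0 h *; set r := rho _ _ _ _ in r0 h *.
  have s16 : s <= 8^-1 by lra.
  have ne : `|C| * s ^+ 2 <= 4^-1.
    apply: (@le_trans _ _ (B * (4 * (n%:R ^+ 2)^-1))).
      by apply: ler_pM => //; rewrite /B; lra.
    rewrite mulrA ler_pdivrMr ?exprn_gt0 // expr2; nra.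
  have [h1 h2] : 1 + s - `|C| * s ^+ 2 <= r /\ r <= 1 + s + `|C| * s ^+ 2.
    by move: h; rewrite ler_norml => /andP[]; split; lra.
  have r12 : 2^-1 <= r by lra.
  (* Multiplication by [r] removes the inverse; since [r >= 1/2], this loses at most a factor 2. *)
  have rE : r * (r^-1 - (1 - s)) = 1 - r * (1 - s).
    by rewrite mulrBr divff ?gt_eqF.
  have e1 : `|r * (r^-1 - (1 - s))| <= (1 + `|C|) * s ^+ 2.
    rewrite rE ler_norml; apply/andP; split; last first.
      have : (1 - s) * (1 + s - `|C| * s ^+ 2) <= (1 - s) * r.
        by rewrite ler_wpM2l //; lra.
      have := mulr_ge0 (mulr_ge0 (ltW s0) sq0) (normr_ge0 C); nra.
    have : (1 - s) * r <= (1 - s) * (1 + s + `|C| * s ^+ 2).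
      by rewrite ler_wpM2l //; lra.
    have := mulr_ge0 (mulr_ge0 (ltW s0) sq0) (normr_ge0 C); nra.
  rewrite normrM (gtr0_norm r0) in e1.
  have e2 : 2^-1 * `|r^-1 - (1 - s)| <= r * `|r^-1 - (1 - s)|.
    by rewrite ler_wpM2r.
  have e3 : (1 + `|C|) * s ^+ 2 <= (1 + `|C|) * (4 * (n%:R ^+ 2)^-1).
    by rewrite ler_wpM2l // addr_ge0.
  have := normr_ge0 C; rewrite /B; lra.
Qed.

End Escape.

(** * Two-sided bounds on the escape probability *)

Section EscapeBounds.
Context {R : realType} (w : walk_kind) (q p1 p2 : nat -> R) (beta : R).
Hypothesis prob_params : forall k, (2 <= k)%N ->
  0 < q k /\ 0 <= p1 k /\ 0 < p2 k /\ q k + p1 k + p2 k = 1.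
Hypothesis beta_ge0 : 0 <= beta.
Hypothesis beta_lt1 : beta < 1.
Hypothesis rho_asymp : exists C : R, exists K : nat, forall k, (K <= k)%N ->
     `|rho q p1 p2 k -
       (if w is W21 then 1 - 3 * r_seq beta k else 1 + 3 * r_seq beta k)|
     <= C * r_seq beta k ^+ 2.
Local Notation stay_prob := (stay_prob w q p1 p2).
Local Notation ratio_limit := (ratio_limit w q p1 p2).
Local Notation llog := (llog beta).
Local Notation gauge := (gauge beta).

Lemma gauge_gt0 n : (0 < n)%N -> 1 <= llog n -> 0 < gauge n.
Proof. by move=> n0 L1; rewrite mulr_gt0 ?ltr0n //; exact: lt_le_trans L1. Qed.

Lemma partial_gauge_bounds (d : nat -> R) (k n : nat) : (k <= n.+1)%N ->
  (forall j, (k <= j)%N ->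
     d j / 2 <= gauge j * d j - gauge j.+1 * d j.+1 <= 2 * d j) ->
  (gauge k * d k - gauge n.+1 * d n.+1) / 2 <= partial d k n <=
  2 * (gauge k * d k - gauge n.+1 * d n.+1).
Proof.
move=> kn bd.
have -> : gauge k * d k - gauge n.+1 * d n.+1 =
    \sum_(k <= j < n.+1) (gauge j * d j - gauge j.+1 * d j.+1).
  rewrite -[LHS]opprB -(telescope_sumr (fun j => gauge j * d j) kn) -sumrN.
  by apply: eq_bigr => j _; rewrite opprB.
rewrite /partial mulr_suml mulr_sumr; apply/andP; split.
- apply: ler_sum_nat => j /andP[kj _]; have /andP[] := bd j kj; lra.
- apply: ler_sum_nat => j /andP[kj _]; have /andP[] := bd j kj; lra.
Qed.

(** The negative correction [- (4 * C + 24)] pushes the quotients of [d] below [ratio_limit]; the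
    opposite sign gives [subsolution]. *)
Lemma supersolution : exists N (d : nat -> R),
  (forall n, (N <= n)%N -> [/\ 0 < d n, d n.+1 <= d n, 0 < gauge n &
    d n / 2 <= gauge n * d n - gauge n.+1 * d n.+1 <= 2 * d n]) /\
  (forall n j, (N < n)%N -> (n <= j.+1 <= n.+2)%N ->
    d j.+1 <= ratio_limit n * d j).
Proof.
have [C [N1 [C0 H1]]] := ratio_limit_asymp prob_params beta_ge0 beta_lt1 rho_asymp.
have [N2 H2] := envelope_ratio_bounds beta_ge0 beta_lt1 C0.
have [N3 [d H3]] := envelope_exists beta_ge0 beta_lt1 (- (4 * C + 24)).
have [N4 H4] := llog_increment beta_ge0 beta_lt1.
exists (N1 + N2 + N3 + N4)%N, d; split => [n Nn|n j Nn nj].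
  have [n3 n4] : (N3 <= n)%N /\ (N4 <= n)%N by clear - Nn; lia.
  have [d0 _ d1 b1 b2] := H3 n n3; have [n16 L1 _ _] := H4 n n4.
  split => //; first by apply: gauge_gt0 => //; exact: leq_trans n16.
  by rewrite b1.
have [n1 n2 j3] : [/\ (N1 <= n)%N, (N2 <= n)%N & (N3 <= j)%N].
  by clear - Nn nj; split; lia.
have [d0 -> _ _ _] := H3 j j3; rewrite ler_pM2r //.
by have /andP[] := H2 n n2 _ (H1 n n1) j.+1 nj.
Qed.

Lemma subsolution : exists N (d : nat -> R),
  (forall n, (N <= n)%N -> [/\ 0 < d n, d n.+1 <= d n, 0 < gauge n &
    d n / 2 <= gauge n * d n - gauge n.+1 * d n.+1 <= 2 * d n]) /\
  (forall n j, (N < n)%N -> (n <= j.+1 <= n.+2)%N ->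
    ratio_limit n * d j <= d j.+1).
Proof.
have [C [N1 [C0 H1]]] := ratio_limit_asymp prob_params beta_ge0 beta_lt1 rho_asymp.
have [N2 H2] := envelope_ratio_bounds beta_ge0 beta_lt1 C0.
have [N3 [d H3]] := envelope_exists beta_ge0 beta_lt1 (4 * C + 24).
have [N4 H4] := llog_increment beta_ge0 beta_lt1.
exists (N1 + N2 + N3 + N4)%N, d; split => [n Nn|n j Nn nj].
  have [n3 n4] : (N3 <= n)%N /\ (N4 <= n)%N by clear - Nn; lia.
  have [d0 _ d1 b1 b2] := H3 n n3; have [n16 L1 _ _] := H4 n n4.
  split => //; first by apply: gauge_gt0 => //; exact: leq_trans n16.
  by rewrite b1.
have [n1 n2 j3] : [/\ (N1 <= n)%N, (N2 <= n)%N & (N3 <= j)%N].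
  by clear - Nn nj; split; lia.
have [d0 -> _ _ _] := H3 j j3; rewrite ler_pM2r //.
by have /andP[] := H2 n n2 _ (H1 n n1) j.+1 nj.
Qed.

Lemma escape_ge : exists N, forall k, (N <= k)%N -> forall m,
  (2 * gauge k.+1)^-1 <= stay_prob [pred y | k < y]%N m k.+1.
Proof.
have [N [d [H1 H2]]] := subsolution.
exists (N + 2)%N => k Nk m.
have Nk1 : (N <= k.+1)%N by clear - Nk; lia.
have [d0 _ g0 _] := H1 k.+1 Nk1.
have d_ge0 j : (k.+1 <= j.+1)%N -> 0 <= d j.
  by move=> kj; have [|/ltW] := H1 j; first by clear - kj Nk; lia.
(* An upper bound for all partial sums from [k + 1] on, by telescoping g d; dividing by it yields a
   function at most 1 whose value at [k + 1] is [d k.+1 / B]. *)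
pose B := 2 * (gauge k.+1 * d k.+1).
have B0 : 0 < B by rewrite mulr_gt0 // mulr_gt0.
have -> : (2 * gauge k.+1)^-1 = B^-1 * partial d k.+1 k.+1.
  rewrite partialS // partial0 // add0r /B; field.
  by rewrite !lt0r_neq0.
apply: (@stay_above_ge _ w q p1 p2 prob_params k
  (fun x => B^-1 * partial d k.+1 x) m k.+1) => // x.
- rewrite mulrC ler_pdivrMr // mul1r.
  have [xk|kx] := leqP x k; first by rewrite partial0 ?ltW.
  have [||_ ub] := andP (partial_gauge_bounds (d := d) (k := k.+1) (n := x) _ _).
  + exact: leqW.
  + by move=> j kj; have [] := H1 j (leq_trans Nk1 kj).
  apply: (le_trans ub); rewrite /B ler_pM2l // lerBlDr lerDl.
  have [dx _ gx _] := H1 x.+1 (leq_trans Nk1 (leqW kx)).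
  by rewrite mulr_ge0 // ltW.
- by move=> xk; rewrite partial0 ?mulr0.
- move=> kx; rewrite mean_stepZ; apply: ler_wpM2l; first by rewrite invr_ge0 ltW.
  apply: (mean_step_sub prob_params) => //.
  + by clear - Nk; lia.
  + by move=> j; apply: H2; clear - Nk kx; lia.
Qed.

(** The supersolution is at most [3 * d k] at the starting points and at least [gauge k * d k / 4]
    at a far level [n], which gives 12. The number [m] of steps is then chosen so that remaining
    below [n] adds at most [1 / gauge k], which gives 13. *)
Lemma escape_le : exists N, forall k, (N <= k)%N -> exists m, forall x,
  (k < x <= k.+2)%N -> stay_prob [pred y | k < y]%N m x <= 13 / gauge k.
Proof.
have [N [d [H1 H2]]] := supersolution.
have [N1 div] := sum_gauge_diverges beta_ge0 beta_lt1.
exists (N + N1 + 2)%N => k Nk.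
have [Nk1 Nk2 k2] : [/\ (N <= k)%N, (N1 <= k)%N & (2 <= k)%N].
  by clear - Nk; split; lia.
have [d0 d01 g0 _] := H1 k Nk1.
have d_ge0 j : (k <= j)%N -> 0 <= d j.
  by move=> kj; have [/ltW] := H1 j (leq_trans Nk1 kj).
have bd j : (k <= j)%N ->
    d j / 2 <= gauge j * d j - gauge j.+1 * d j.+1 <= 2 * d j.
  by move=> kj; have [] := H1 j (leq_trans Nk1 kj).
have [n kn small] : exists2 n, (k <= n)%N &
    gauge n.+1 * d n.+1 <= gauge k * d k / 2.
  (* Otherwise g d never falls below half its value at [k], so each decrement is at least [u k / 4]
     times [1 / gauge j]. Since these inverses have a divergent sum, a stretch with sum at least 8
     would force a total drop of [2 * u k], although g d stays positive. *)
  apply: contrapT => large.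
  have [n kn big] := div k 8 Nk2.
  have u_large j : (k <= j)%N -> gauge k * d k / 2 <= gauge j * d j.
    rewrite leq_eqVlt => /orP[/eqP <-|].
      by have := mulr_gt0 g0 d0; lra.
    case: j => // j kj; apply/ltW; rewrite ltNge; apply/negP => h.
    by apply: large; exists j.
  pose u j := gauge j * d j; have u0 : 0 < u k by exact: mulr_gt0.
  have : \sum_(k <= j < n) u k / 4 * (gauge j)^-1 <= \sum_(k <= j < n) (u j - u j.+1).
    apply: ler_sum_nat => j /andP[kj _]; have /andP[lb _] := bd j kj.
    apply: le_trans lb; have [_ _ gj _] := H1 j (leq_trans Nk1 kj).
    by rewrite ler_pdivrMr //; have := u_large j kj; rewrite -/(u k); lra.
  rewrite -mulr_sumr.
  have tele : \sum_(k <= j < n) (u j - u j.+1) = u k - u n.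
    rewrite -[RHS]opprB -(telescope_sumr u kn) -sumrN.
    by apply: eq_bigr => j _; rewrite opprB.
  rewrite tele => h1; have un : 0 < u n.
    by have [dn _ gn _] := H1 n (leq_trans Nk1 kn); exact: mulr_gt0.
  have : u k / 4 * 8 <= u k / 4 * \sum_(k <= j < n) (gauge j)^-1.
    by apply: ler_wpM2l => //; lra.
  lra.
have nk1 : (k <= n.+1)%N by exact: leqW.
have /andP[lb _] := partial_gauge_bounds nk1 bd.
have small' : gauge k * d k / 4 <= partial d k n by lra.
have hn0 : 0 < partial d k n.
  by apply: lt_le_trans small'; rewrite divr_gt0 // mulr_gt0.
have e0 : 0 < (gauge k)^-1 by rewrite invr_gt0.
have decr j : (k <= j)%N -> d j <= d k.
  move=> /subnKC <-; elim: (j - k)%N => [|r IH]; first by rewrite addn0.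
  have [|_ h _ _] := H1 (k + r)%N; first by rewrite (leq_trans Nk1) // leq_addr.
  by apply: le_trans IH; rewrite addnS.
have [m hm] := stay_below_small w prob_params n e0.
exists m => x kx.
have ge0 z : 0 <= partial d k z by exact: partial_ge0.
have mono z : (n <= z)%N -> partial d k n <= partial d k z by exact: partial_le.
apply: le_trans (@stay_above_le _ w q p1 p2 prob_params k n (partial d k) m x ge0 hn0 mono _) _.
  move=> z /andP[kz _]; apply: (mean_step_super prob_params) => // j.
  by apply: H2; clear - kz Nk; lia.
have hx : partial d k x <= 3 * d k.
  apply: (@le_trans _ _ (partial d k k.+2)).
    by apply: partial_le => //; case/andP: kx.
  have kk : (k < k.+2)%N by [].
  rewrite partialS ?leqW // partialS ?leqnSn //.
  have -> : partial d k k = d k by rewrite /partial big_nat1.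
  have h1 := decr k.+1 (leqnSn k); have h2 := decr k.+2 (leqW (leqnSn k)); lra.
have h12 : partial d k x / partial d k n <= 12 / gauge k.
  rewrite ler_pdivrMr // mulrAC ler_pdivlMr //.
  apply: (@le_trans _ _ (3 * d k * gauge k)).
    by rewrite ler_wpM2r // ltW.
  lra.
by have := lerD h12 (hm x); lra.
Qed.

End EscapeBounds.

(** * Upper and lower limits, the subsequence 2 ^ (2 ^ j), and almost sure convergence from summable
    means *)

Section LimitLemmas.
Context {R : realType}.

Lemma limn_esup_le (u : nat -> \bar R) (l : \bar R) N :
  (forall n, (N <= n)%N -> (u n <= l)%E) -> (limn_esup u <= l)%E.
Proof.
move=> ul; rewrite /limn_esup limf_esupE.
apply: (@le_trans _ _ (ereal_sup (u @` [set n | (N <= n)%N]))).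
  by apply: ereal_inf_lbound; exists [set n | (N <= n)%N] => //; exists N.
by apply: ub_ereal_sup => _ [n /= Nn <-]; exact: ul.
Qed.

Lemma limn_einf_ge (u : nat -> \bar R) (l : \bar R) N :
  (forall n, (N <= n)%N -> (l <= u n)%E) -> (l <= limn_einf u)%E.
Proof.
move=> ul; rewrite /limn_einf leeNr; apply: (@limn_esup_le _ _ N) => n Nn.
by rewrite leeN2 ul.
Qed.

(** The logarithm doubles at each step: negative powers of it are summable, while consecutive terms
    remain comparable. *)
Definition tower (j : nat) : nat := 2 ^ (2 ^ j).

Lemma towerS j : tower j.+1 = (tower j * tower j)%N.
Proof. by rewrite /tower expnS mulSn mul1n expnD. Qed.

Lemma ln_towerS j : ln ((tower j.+1)%:R : R) = 2 * ln (tower j)%:R.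
Proof.
have t0 : (0 : R) < (tower j)%:R by rewrite ltr0n expn_gt0.
by rewrite towerS natrM lnM ?posrE // mulr_natl mulr2n.
Qed.

Lemma ltn_tower j : (j < tower j)%N.
Proof. by rewrite (ltn_trans (ltn_expl j (isT : 1 < 2)%N)) // ltn_expl. Qed.

Lemma between_towers J n : (tower J <= n)%N ->
  exists2 j, (J <= j)%N & (tower j <= n < tower j.+1)%N.
Proof.
move=> Jn.
have ex : exists j, (n < tower j)%N by exists n; exact: ltn_tower.
have mono i k : (i <= k)%N -> (tower i <= tower k)%N.
  by move=> ik; rewrite leq_exp2l // leq_exp2l.
case: (ex_minnP ex) => -[|j] nj jmin.
  by have := mono 0%N J (leq0n J); lia.
have jn : (tower j <= n)%N.
  by rewrite leqNgt; apply/negP => /jmin; rewrite ltnn.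
exists j; last by rewrite jn.
rewrite leqNgt; apply/negP => jJ; have := mono j.+1 J jJ; lia.
Qed.

(** The series of the [f j] has finite expectation, so it converges almost surely and its terms tend
    to 0. *)
Lemma summable_cvg0 (d : measure_display) (T : measurableType d)
  (P : probability T R) (f : nat -> T -> R) (M : nat -> R) (B : R) :
  (forall j o, 0 <= f j o) -> (forall j, measurable_fun setT (f j)) ->
  (forall j, (\int[P]_o (f j o)%:E <= (M j)%:E)%E) ->
  (forall n, \sum_(0 <= j < n) M j <= B) ->
  {ae P, forall o, f ^~ o @ \oo --> (0 : R)}.
Proof.
move=> f0 mf fM MB.
pose F o := (\sum_(0 <= j <oo) (f j o)%:E)%E.
have mfE j : measurable_fun setT (EFin \o f j) by exact/measurable_EFinP.
have F0 o : (0 <= F o)%E by apply: nneseries_ge0 => j _ _; rewrite lee_fin.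
have mF : measurable_fun setT F.
  apply: ge0_emeasurable_sum => [j o _ _|j _]; [by rewrite lee_fin|exact: mfE].
have iF : P.-integrable setT F.
  apply/integrableP; split => //.
  under eq_integral do rewrite gee0_abs //.
  rewrite /F integral_nneseries //; last by move=> j o _; rewrite lee_fin.
  apply: (@le_lt_trans _ _ B%:E); last exact: ltry.
  apply: lime_le.
    by apply: is_cvg_nneseries => j _ _; apply: integral_ge0 => o _; rewrite lee_fin.
  apply: nearW => n.
  apply: (@le_trans _ _ (\sum_(0 <= j < n) (M j)%:E)%E).
    by apply: lee_sum => j _; exact: fM.
  by rewrite sumEFin lee_fin MB.
have := integrable_ae measurableT iF; apply: filterS => o /(_ I) Ffin.
apply: cvg_series_cvg_0; apply: nondecreasing_is_cvgn.
  by apply/nondecreasing_seqP => n; rewrite /series /= big_nat_recr //= lerDl.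
exists (fine (F o)) => _ [n _ <-].
rewrite /series /= -lee_fin fineK // -sumEFin.
by apply: nneseries_lim_ge => j _ _; rewrite lee_fin.
Qed.

End LimitLemmas.

(** * The expected number of cutpoints *)

Section CutpointCount.
Context {R : realType} {d : measure_display} {T : measurableType d}.
Context (P : probability T R) (w : walk_kind) (q p1 p2 : nat -> R).
Context (Z : nat -> T -> nat) (beta : R).
Hypothesis prob_params : forall k, (2 <= k)%N ->
  0 < q k /\ 0 <= p1 k /\ 0 < p2 k /\ q k + p1 k + p2 k = 1.
Hypothesis Zwalk : is_walk w q p1 p2 P Z.
Local Notation gauge := (gauge beta).
Local Notation llog := (llog beta).
Local Notation S_count := (@S_count R w T Z).

Definition cut_prob (k : nat) : R := fine (P [set o | cutpoint w Z k o]).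

Lemma cut_probE k : P [set o | cutpoint w Z k o] = (cut_prob k)%:E.
Proof.
by rewrite /cut_prob fineK // fin_num_measure //; exact: (measurable_cutpoint Zwalk).
Qed.

Lemma cut_prob_ge0 k : 0 <= cut_prob k.
Proof. by apply: fine_ge0. Qed.

Lemma cut_prob_le1 k : cut_prob k <= 1.
Proof.
by rewrite -lee_fin -cut_probE probability_le1 //; exact: (measurable_cutpoint Zwalk).
Qed.

Lemma S_count_ge0 n o : 0 <= S_count n o.
Proof. by apply: sumr_ge0 => k _; rewrite indicE. Qed.

Lemma le_S_count m n o : (m <= n)%N -> S_count m o <= S_count n o.
Proof.
move=> /subnKC <-; elim: (n - m)%N => [|i IH]; first by rewrite addn0.
apply: (le_trans IH); rewrite addnS /S_count.
have [h|h] := leqP 2 (m + i).+1; last by rewrite !big_geq //; lia.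
by rewrite [leRHS]big_nat_recr //= lerDl indicE.
Qed.

Lemma measurable_S_count n : measurable_fun setT (S_count n).
Proof.
apply: measurable_sum => k.
exact: measurable_indic (measurable_cutpoint Zwalk k).
Qed.

Lemma expectation_S_count n :
  (\int[P]_o (S_count n o)%:E)%E = (\sum_(2 <= k < n.+1) cut_prob k)%:E.
Proof.
rewrite /S_count; under eq_integral do rewrite -sumEFin.
rewrite ge0_integral_sum //; last first.
  move=> k; apply/measurable_EFinP.
  exact: measurable_indic (measurable_cutpoint Zwalk k).
rewrite -sumEFin; apply: eq_bigr => k _.
have mk := measurable_cutpoint Zwalk k.
by rewrite integral_indic // setIT; exact: cut_probE.
Qed.

Hypothesis a_cvg : exists a : R, 0 < a /\ a_seq q p1 p2 k @[k --> \oo] --> a.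
Hypothesis b_cvg : exists b : R, 0 < b /\ b_seq q p2 k @[k --> \oo] --> b.

(** Gives the step probabilities of the bridge: [q k] is [1 / (1 + a_k)] with [a_k <= 1 + a]
    eventually, and [p2 k] is [b_k q k] with [b_k >= b / 2]. *)
Lemma params_bounded_below : exists c N, 0 < c /\
  forall k, (N <= k)%N -> c <= q k /\ c <= p2 k.
Proof.
have [a [a0 ca]] := a_cvg; have [b [b0 cb]] := b_cvg.
have [N1 _ H1] := (cvgrPdist_le _ _).1 ca 1 ltr01.
have b20 : 0 < b / 2 by rewrite divr_gt0.
have [N2 _ H2] := (cvgrPdist_le _ _).1 cb _ b20.
pose c0 := (2 + a)^-1; have c00 : 0 < c0 by rewrite invr_gt0; lra.
exists (Num.min c0 (b / 2 * c0)), (N1 + N2 + 2)%N; split.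
  by rewrite lt_min c00 mulr_gt0.
move=> k Nk; have [k1 k2 k3] : [/\ (N1 <= k)%N, (N2 <= k)%N & (2 <= k)%N].
  by clear - Nk; split; lia.
have [q0 [p10 [p20 pE]]] := prob_params k3.
have := H1 k k1; have := H2 k k2; rewrite /= !ler_norml => /andP[_ hb] /andP[ha _].
have aE : q k * a_seq q p1 p2 k = p1 k + p2 k.
  by rewrite /a_seq mulrCA divff ?mulr1 // gt_eqF.
have bE : q k * b_seq q p2 k = p2 k.
  by rewrite /b_seq mulrCA divff ?mulr1 // gt_eqF.
have qc : c0 <= q k.
  have : q k * a_seq q p1 p2 k <= q k * (1 + a) by rewrite ler_wpM2l ?(ltW q0) //; lra.
  rewrite aE => h; have a2 : 0 < 2 + a by lra.
  rewrite -(ler_pM2r a2) mulVf ?gt_eqF //.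
  move: h pE; move: (q k) (p1 k) (p2 k) => x y z; lra.
split; first by rewrite ge_min qc.
rewrite ge_min; apply/orP; right; rewrite -bE mulrC.
by apply: ler_pM; rewrite ?(ltW b20) ?(ltW c00) //; lra.
Qed.

Hypothesis beta_ge0 : 0 <= beta.
Hypothesis beta_lt1 : beta < 1.
Hypothesis rho_asymp : exists C : R, exists K : nat, forall k, (K <= k)%N ->
     `|rho q p1 p2 k -
       (if w is W21 then 1 - 3 * r_seq beta k else 1 + 3 * r_seq beta k)|
     <= C * r_seq beta k ^+ 2.

Lemma cut_prob_bounds : exists c N, 0 < c /\ forall k, (N <= k)%N ->
  c / gauge k.+1 <= cut_prob k <= 13 / gauge k.
Proof.
have [c [N1 [c0 H1]]] := params_bounded_below.
have [N2 H2] := escape_ge prob_params beta_ge0 beta_lt1 rho_asymp.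
have [N3 H3] := escape_le prob_params beta_ge0 beta_lt1 rho_asymp.
have [N4 H4] := llog_increment beta_ge0 beta_lt1.
exists (c ^+ 3 / 2), (N1 + N2 + N3 + N4 + 8)%N; split.
  by rewrite divr_gt0 // exprn_gt0.
move=> k Nk; have [k1 k2 k3 k4 k5] : [/\ (N1 + 8 <= k)%N, (N2 <= k)%N, (N3 <= k)%N,
    (N4 <= k)%N & (N4 <= k.+1)%N] by clear - Nk; split; lia.
have gt0 j : (N4 <= j)%N -> 0 < gauge j.
  move=> /H4 [j16 L1 _ _]; apply: gauge_gt0 => //; exact: leq_trans j16.
rewrite -!lee_fin -cut_probE; apply/andP; split.
- rewrite -mulrA -invfM.
  apply: (cutpoint_prob_ge Zwalk prob_params (c := c)) => //.
  + by clear - k1; lia.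
  + exact: ltW.
  + by rewrite invr_ge0 mulr_ge0 // ltW // gt0.
  + by move=> j kj; apply: H1; clear - kj k1; lia.
  + exact: H2.
- have [m hm] := H3 k k3.
  apply: (cutpoint_prob_le Zwalk prob_params (m := m)) => //.
  + by clear - k1; lia.
  + by rewrite divr_ge0 // ltW // gt0.
Qed.

Lemma sum_cut_prob_bounds : exists c C N, [/\ 0 < c, 0 < C & forall n, (N <= n)%N ->
  [/\ 1 <= llog n, 1 <= ln n%:R :> R &
   c * (ln n%:R / llog n) <= \sum_(2 <= k < n.+1) cut_prob k <=
   C * (ln n%:R / llog n)] ].
Proof.
have [c [N1 [c0 H1]]] := cut_prob_bounds.
have [N2 H2] := sum_gauge_ge beta_ge0 beta_lt1.
have [N3 H3] := sum_gauge_le beta_ge0 beta_lt1.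
have [N4 H4] := llog_increment beta_ge0 beta_lt1.
pose m := (N1 + N2 + N3 + 2)%N.
have [m1 m2 m3 m4] : [/\ (N1 <= m)%N, (N2 <= m.+1)%N, (N3 <= m)%N & (2 <= m)%N].
  by rewrite /m; split; lia.
have [N5 H5] := @near_ln_ge R (2 * ln m.+1%:R).
have i0 : 0 < (m.+1%:R : R)^-1 by rewrite invr_gt0 ltr0n.
have [N6 H6] := llog_small beta_ge0 beta_lt1 i0.
(* Half of [c] pays for [ln n - ln m.+1 >= ln n / 2]. In 27, the tail accounts for 26 = 13 * 2, and
   the sites up to [m] for 1, as their number is at most [ln n / llog n] for large [n]. *)
exists (c / 2), 27, (m.+2 + N4 + N5 + N6)%N; split => //; first by rewrite divr_gt0.
move=> n Nn; have [n1 n2 n3 n4] : [/\ (m.+1 <= n)%N, (N4 <= n)%N, (N5 <= n)%N & (N6 <= n)%N].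
  by clear - Nn; split; lia.
have [n16 L1 _ [_ l1]] := H4 n n2; split => //.
have L0 : 0 < llog n by exact: lt_le_trans L1.
apply/andP; split.
- have mn1 : (m <= n.-1)%N by clear - n1; lia.
  apply: (@le_trans _ _ (\sum_(m <= k < n.-1) cut_prob k)).
    apply: (@le_trans _ _ (\sum_(m <= k < n.-1) c / gauge k.+1)).
      rewrite -mulr_sumr -mulrA ler_pM2l //.
      have -> : \sum_(m <= k < n.-1) (gauge k.+1)^-1 = \sum_(m.+1 <= k < n) (gauge k)^-1.
        by rewrite -[in RHS](prednK (n := n)) ?big_add1 //; clear - n1; lia.
      apply: le_trans (H2 m.+1 n m2 n1).
      rewrite mulrA ler_wpM2r ?invr_ge0 ?(ltW L0) //; have := H5 n n3; lra.
    apply: ler_sum_nat => k /andP[mk _].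
    by have /andP[] := H1 k (leq_trans m1 mk).
  rewrite [leRHS](big_cat_nat (n := n.-1)) /=; [|by clear - n1 m4; lia|by clear - n1; lia].
  rewrite [X in _ <= X + _](big_cat_nat (n := m)) //=.
  have s0 i j : 0 <= \sum_(i <= k < j) cut_prob k.
    by apply: sumr_ge0 => k _; exact: cut_prob_ge0.
  by rewrite -addrA addrCA lerDl addr_ge0.
- have mn1 : (m.+1 <= n.+1)%N by exact: leqW.
  rewrite (big_cat_nat (n := m.+1)) //=; last by clear - m4; lia.
  have first_le : \sum_(2 <= k < m.+1) cut_prob k <= ln n%:R / llog n.
    apply: (@le_trans _ _ (\sum_(2 <= k < m.+1) 1)).
      by apply: ler_sum => k _; exact: cut_prob_le1.
    rewrite sumr_const_nat ler_pdivlMr //.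
    have := H6 n n4; rewrite mulrC ler_pdivlMr ?ltr0n // => h6.
    apply: le_trans h6; rewrite mulrC; apply: ler_wpM2l; first exact: ltW.
    by rewrite ler_nat; lia.
  have second_le : \sum_(m.+1 <= k < n.+1) cut_prob k <= 26 * (ln n%:R / llog n).
    apply: (@le_trans _ _ (\sum_(m.+1 <= k < n.+1) 13 / gauge k)).
      apply: ler_sum_nat => k /andP[mk _].
      by have /andP[] := H1 k (leq_trans m1 (ltnW mk)).
    rewrite -mulr_sumr big_add1 /=.
    have := H3 m n m3 (ltnW n1); lra.
  lra.
Qed.

End CutpointCount.

(** * The almost sure upper bound *)

Section AlmostSure.
Context {R : realType} {d : measure_display} {T : measurableType d}.
Context (P : probability T R) (w : walk_kind) (q p1 p2 : nat -> R).
Context (Z : nat -> T -> nat) (beta : R).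
Hypothesis Zwalk : is_walk w q p1 p2 P Z.
Hypothesis beta_ge0 : 0 <= beta.
Hypothesis beta_lt1 : beta < 1.
Local Notation llog := (llog beta).
Local Notation S_count := (@S_count R w T Z).
Local Notation cut_prob := (cut_prob P w Z).

Lemma S_count_negligible_growth (C : R) N (eps : R) : 0 < eps -> 0 < C ->
  (forall n, (N <= n)%N -> [/\ 1 <= llog n, 1 <= ln n%:R :> R &
     \sum_(2 <= k < n.+1) cut_prob k <= C * (ln n%:R / llog n)]) ->
  {ae P, forall o, (fun n => S_count n o / ((ln n%:R) `^ (1 + eps) / llog n))
     @ \oo --> (0 : R)}.
Proof.
move=> e0 C0 HN; have [N' mono] := llog_homo beta_ge0 beta_lt1.
(* Since [j < tower j], the shift by [J] puts every [t j] beyond both thresholds. *)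
pose J := (N + N')%N; pose t j := tower (j + J).
have Nt j : (N <= t j)%N.
  by rewrite /t; have := ltn_tower (j + J); rewrite /J; clear; lia.
pose D n := (ln n%:R) `^ (1 + eps) / llog n.
have D0 n : (N <= n)%N -> 0 < D n.
  move=> /HN [L1 l1 _]; rewrite divr_gt0 ?powR_gt0 //; lra.
pose f j o := (D (t j))^-1 * S_count (t j) o.
(* The bound on the normalised expectation at [t j]; it is geometric with quotient [2 ^ (- eps)]
   because [ln (t j)] doubles. *)
pose M j := C * (ln (t j)%:R) `^ (- eps).
pose r : R := 2 `^ (- eps).
have r1 : r < 1.
  have : 1 `^ eps < 2 `^ eps :> R.
    by apply: gt0_ltr_powR; rewrite ?nnegrE // ltr1n.
  by rewrite powR1 /r powRN invf_lt1 ?powR_gt0.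
have MS j : M j.+1 = r * M j.
  have l1 : 1 <= ln (t j)%:R :> R by have [] := HN _ (Nt j).
  by rewrite /M /t addSn ln_towerS powRM ?ler0n //; [rewrite mulrCA | lra].
have M0 j : 0 <= M j by rewrite mulr_ge0 ?powR_ge0 // ltW.
have sumM n : (1 - r) * \sum_(0 <= j < n) M j = M 0%N - M n.
  elim: n => [|n IH]; first by rewrite big_geq // mulr0 subrr.
  by rewrite big_nat_recr //= mulrDr IH MS; ring.
have f_cvg : {ae P, forall o, f ^~ o @ \oo --> (0 : R)}.
  apply: (@summable_cvg0 _ _ _ P f M ((1 - r)^-1 * M 0%N)).
  - by move=> j o; rewrite mulr_ge0 ?S_count_ge0 // invr_ge0 ltW // D0.
  - by move=> j; apply: measurable_funM => //; exact: (measurable_S_count Zwalk).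
  - move=> j; have [L1 l1 hsum] := HN _ (Nt j).
    under eq_integral do rewrite /f EFinM.
    rewrite ge0_integralZl_EFin //; last first.
    + by rewrite invr_ge0 ltW // D0.
    + by apply/measurable_EFinP; exact: (measurable_S_count Zwalk).
    + by move=> o _; rewrite lee_fin S_count_ge0.
    rewrite (expectation_S_count Zwalk) -EFinM lee_fin.
    apply: (@le_trans _ _ ((D (t j))^-1 * (C * (ln (t j)%:R / llog (t j))))).
      by rewrite ler_wpM2l // invr_ge0 ltW // D0.
    rewrite /M /D le_eqVlt; apply/orP; left; apply/eqP.
    have l0 : 0 < ln (t j)%:R :> R by lra.
    have L0 : 0 < llog (t j) by lra.
    rewrite powRD; last by rewrite (gt_eqF l0) implybT.
    rewrite powRr1 ?ltW // powRN; field.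
    by rewrite !lt0r_neq0 ?powR_gt0.
  - move=> n; rewrite mulrC ler_pdivlMr ?subr_gt0 // mulrC sumM.
    by rewrite lerBlDr lerDl.
apply: filterS f_cvg => o fo.
(* If [n] lies between [tower j] and [tower j.+1], then [D (tower j.+1) <= B * D n]: the logarithm
   at most doubles and [llog] does not decrease. With the monotonicity of [S_count], this controls
   all [n] by the subsequence. *)
pose B : R := 2 `^ (1 + eps).
have B0 : 0 < B by rewrite powR_gt0.
apply/cvgrPdist_le => e ep.
have eB : 0 < e / B by rewrite divr_gt0.
have [j1 _ Hj] := (cvgrPdist_le _ _).1 fo _ eB.
exists (tower (j1 + J)%N) => // n /= tn.
have [j Jj /andP[tj tj1]] := between_towers tn.
have jE : tower j.+1 = t (j.+1 - J)%N.
  by rewrite /t subnK //; clear - Jj; lia.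
have := Hj (j.+1 - J)%N ltac:(clear - Jj; simpl; lia).
have Nj : (N <= n)%N /\ (N' <= n)%N.
  by have := ltn_tower (j1 + J); rewrite /J in tn *; clear - tn; lia.
have [Nn Nn'] := Nj.
rewrite !sub0r !normrN /f -jE.
have tN : (N <= tower j.+1)%N by rewrite jE.
rewrite !ger0_norm; first last.
- by rewrite mulr_ge0 ?S_count_ge0 // invr_ge0 ltW // D0.
- by rewrite mulr_ge0 ?S_count_ge0 // invr_ge0 ltW // D0.
rewrite ler_pdivlMr // => small; apply: le_trans small.
have S1 : S_count n o <= S_count (tower j.+1) o by apply: le_S_count; exact: ltnW.
rewrite mulrC mulrAC -/(D n); apply: ler_pM.
- by rewrite invr_ge0 ltW // D0.
- exact: S_count_ge0.
- have [L1 l1 _] := HN n Nn; have [L1' l1' _] := HN _ tN.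
  rewrite -[leRHS]invrK lef_pV2 ?posrE ?D0 ?invr_gt0 ?mulr_gt0 ?invr_gt0 ?D0 //.
  rewrite invfM invrK ler_pdivrMr // /D.
  have LL := mono n (tower j.+1) Nn' (ltnW tj1).
  have ll : ln (tower j.+1)%:R <= 2 * ln n%:R :> R.
    rewrite ln_towerS ler_pM2l // ler_ln ?posrE ?ltr0n ?expn_gt0 //.
      by rewrite ler_nat.
    by rewrite (leq_trans _ tj) // expn_gt0.
  rewrite mulrAC; apply: ler_pM.
  + exact: powR_ge0.
  + by rewrite invr_ge0; lra.
  + rewrite mulrC /B -powRM ?ler0n //; last lra.
    by apply: ge0_ler_powR; rewrite ?nnegrE //; lra.
  + by rewrite lef_pV2 ?posrE //; lra.
- exact: S1.
Qed.

End AlmostSure.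

Unset Implicit Arguments.

Theorem theorem2 (R : realType) (d : measure_display) (T : measurableType d)
  (P : probability T R) (w : walk_kind) (q p1 p2 : nat -> R)
  (Z : nat -> T -> nat) (beta : R) :
  (forall k, (2 <= k)%N ->
     0 < q k /\ 0 <= p1 k /\ 0 < p2 k /\ q k + p1 k + p2 k = 1) ->
  is_walk w q p1 p2 P Z ->
  (exists a : R, 0 < a /\ a_seq q p1 p2 k @[k --> \oo] --> a) ->
  (exists b : R, 0 < b /\ b_seq q p2 k @[k --> \oo] --> b) ->
  0 <= beta ->
  (exists C : R, exists K : nat, forall k, (K <= k)%N ->
     `|rho q p1 p2 k -
       (if w is W21 then 1 - 3 * r_seq beta k else 1 + 3 * r_seq beta k)|
     <= C * r_seq beta k ^+ 2) ->
  beta < 1 ->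
  (exists c3 c4 : R, 0 < c3 /\ c3 < c4 /\
     let u := fun n : nat =>
       ((\int[P]_o (@S_count R w T Z n o)%:E) *
        ((ln n%:R * (ln (ln n%:R)) `^ (- beta))^-1)%:E)%E in
     (c3%:E <= limn_einf u)%E /\ (limn_einf u <= limn_esup u)%E /\
     (limn_esup u <= c4%:E)%E) /\
  (forall eps : R, 0 < eps ->
     {ae P, forall o, (fun n : nat => @S_count R w T Z n o /
        ((ln n%:R) `^ (1 + eps) * (ln (ln n%:R)) `^ (- beta))) @ \oo --> 0}).
Proof.
move=> prob_params Zwalk a_cvg b_cvg beta_ge0 rho_asymp beta_lt1.
have [c [C [N [c0 C0 HN]]]] := sum_cut_prob_bounds prob_params Zwalk a_cvg b_cvg
  beta_ge0 beta_lt1 rho_asymp.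
have llogN n : ln (ln n%:R) `^ (- beta) = (llog beta n)^-1 :> R.
  by rewrite powRN llog.unlock.
split.
(* Taking [c + C] instead of [C] makes the inequality between the two constants strict. *)
- exists c, (c + C); split => //; split; first by rewrite ltrDl.
  pose G n : R := ln n%:R / llog beta n.
  have uE n : ((\int[P]_o (@S_count R w T Z n o)%:E) *
      ((ln n%:R * (ln (ln n%:R)) `^ (- beta))^-1)%:E)%E =
      ((\sum_(2 <= k < n.+1) cut_prob P w Z k) / G n)%:E.
    by rewrite (expectation_S_count Zwalk) llogN -EFinM.
  have bounds n : (N <= n)%N ->
      c <= (\sum_(2 <= k < n.+1) cut_prob P w Z k) / G n <= C.
    move=> /HN [L1 l1 /andP[lb ub]].
    have G0 : 0 < G n by rewrite divr_gt0 //; lra.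
    by rewrite ler_pdivlMr // ler_pdivrMr // lb.
  move=> u; split; [|split].
  + apply: (@limn_einf_ge _ _ _ N) => n /bounds /andP[lb _].
    by rewrite /u uE lee_fin.
  + exact: limn_einf_sup.
  + apply: (@limn_esup_le _ _ _ N) => n /bounds /andP[_ ub].
    by rewrite /u uE lee_fin; lra.
- move=> eps e0.
  have := S_count_negligible_growth Zwalk beta_ge0 beta_lt1 e0 C0.
  move=> /(_ N) as_cvg; apply: filterS (as_cvg _) => [ o|n /HN [L1 l1 /andP[_ ub]] //].
  by under eq_fun do rewrite -llogN.
Qed.
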